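(* Let $S$ be a self-similar IFS of $\mathbb{R}^d$ with attractor $K$ and let $\mu$ be a self-similar measure associated with $S$. Let $\mathcal{B}=(B_n)_{n\in\mathbb{N}}$ be a sequence of closed balls centered on $K$ such that $\lim_{n\to+\infty}|B_n|=0$. Let $\delta\ge 1$ and write $\mathring{B}_n^{\delta}$ for the interior of $B_n^\delta$. (1) Suppose that $(B_n)_{n\in\mathbb{N}}$ is $\mu$-a.c. Then $t(\mu,\delta,\mathcal{B})\le\dim(\mu)$; consequently $s\big(\mu,(B_n)_{n\in\mathbb{N}},(\mathring{B}_n^{\delta})_{n\in\mathbb{N}}\big)\ge\frac{\dim(\mu)}{\delta}$, and there exists a gauge function $\zeta$ such that $\lim_{r\to0^+}\frac{\log\zeta(r)}{\log r}\ge\frac{\dim(\mu)}{\delta}$ and $\mathcal{H}^\zeta(\limsup_{n\to\infty}\mathring{B}_n^{\delta})>0$. In particular $$\dim_H\Big(\limsup_{n\to+\infty}\mathring{B}_n^{\delta}\Big)\ge\frac{\dim(\mu)}{\delta}.\qquad( * )$$ (2) Suppose that $\mu(\limsup_{n\to+\infty}B_n)=1$. Then $( * )$ still holds. Furthermore, if $\mu$ is doubling, then $(B_n)_{n\in\mathbb{N}}$ is $\mu$-a.c., so that all the conclusions of item (1) hold.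
   Context: $\mathbb{R}^d$ is endowed with $\|\cdot\|_\infty$; $B(x,r)$ is the closed ball, $|B|$ the diameter; for $B=B(x,r)$, $B^\delta=B(x,r^\delta)$. $\limsup_n A_n=\bigcap_N\bigcup_{n\ge N}A_n$. A self-similar IFS is a family $S=\{f_i\}_{i=1}^m$ of $m\ge2$ contracting similarities of $\mathbb{R}^d$; no separation condition is assumed. Its attractor $K$ is the unique non-empty compact set with $K=\bigcup_i f_i(K)$. Given a probability vector $(p_i)\in(0,1)^m$, the associated self-similar measure is the unique probability measure with $\mu=\sum_i p_i\,\mu\circ f_i^{-1}$. Such $\mu$ is exact dimensional: $\underline{\dim}_H(\mu)=\mathrm{ess\,inf}_\mu\liminf_{r\to0^+}\frac{\log\mu(B(x,r))}{\log r}$ and $\overline{\dim}_P(\mu)=\mathrm{ess\,sup}_\mu\limsup_{r\to0^+}\frac{\log\mu(B(x,r))}{\log r}$ coincide; the common value is $\dim(\mu)$. Doubling: there is $C>0$ with $\mu(B(x,2r))\le C\mu(B(x,r))$ for all $x\in\mathrm{supp}(\mu)$, $r>0$. A gauge function is $\zeta:\mathbb{R}^+\to\mathbb{R}^+$, increasing near $0$, $\zeta(0)=0$; $\mathcal{H}^\zeta(E)=\lim_{t\to0^+}\inf\{\sum_n\zeta(|L_n|):|L_n|\le t,\ L_n\text{ closed balls},\ E\subset\bigcup_nL_n\}$. $\mathcal{H}^s_\infty(E)=\inf\{\sum_n|L_n|^s: L_n\text{ closed balls},\ E\subset\bigcup_n L_n\}$. $\mu$-a.c.: a countable family of balls $(B_n)_{n\in\mathcal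 N}$, $\mathcal N\subset\mathbb{N}$, is $\mu$-a.c. if there is $C>0$ such that for every open $\Omega\subset\mathbb{R}^d$ and $g\in\mathbb{N}$ there is a (possibly empty) finite family of pairwise disjoint balls $B_{n_i}\subset\Omega$, $n_i\in\mathcal N$, $n_i\ge g$, with $\mu(\bigcup_iB_{n_i})\ge C\mu(\Omega)$. $\mathcal{H}^{\mu,s}_\infty(A)=\inf\{\mathcal{H}^s_\infty(E):E\subset A\text{ Borel},\ \mu(E)=\mu(A)\}$; $s_\mu(B,U)=\sup\{s\ge0:\mathcal{H}^{\mu,s}_\infty(U)\ge\mu(B)\}$; $\mathcal{N}_\mu(\mathcal{B},\mathcal{U},s)=\{n:s_\mu(B_n,U_n)\ge s\}$; $s(\mu,\mathcal{B},\mathcal{U})=\sup\{s\ge0:(B_n)_{n\in\mathcal{N}_\mu(\mathcal{B},\mathcal{U},s)}\text{ is }\mu\text{-a.c.}\}$ ($\sup\emptyset=-\infty$). For small $\varepsilon>0$ (when $\underline{\dim}_H(\mu)>0$), $t(\mu,\delta,\varepsilon,\mathcal{B})=\limsup_{n\to+\infty}\frac{\log\mathcal{H}^{\mu,\underline{\dim}_H(\mu)-\varepsilon}_\infty(\mathring{B}_n^\delta)}{\log|B_n^\delta|}$ and $t(\mu,\delta,\mathcal{B})=\lim_{\varepsilon\to0}t(\mu,\delta,\varepsilon,\mathcal{B})$. *)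

(* Defs.v *)
From HB Require Import structures.
From mathcomp Require Import all_boot all_order all_algebra.
From mathcomp Require Import all_classical all_reals all_analysis.
From mathcomp Require Import ess_sup_inf.

Set Implicit Arguments.
Unset Strict Implicit.
Unset Printing Implicit Defensive.

Import Order.TTheory GRing.Theory Num.Theory.
Import numFieldNormedType.Exports.

Local Open Scope classical_set_scope.
Local Open Scope ring_scope.
Local Open Scope ereal_scope.

(* The norm of 'rV[R]_d, and hence its balls and topology, is the sup norm. *)

(* R^d with its Borel sigma-algebra *)
Definition borel_rV (R : realType) (d : nat) :=
  g_sigma_algebraType (@open 'rV[R]_d).

Section metric.
Context {R : realType} {d : nat}.
Local Notation V := 'rV[R]_d.

Definition euclidean_norm (x : V) : R := Num.sqrt (\sum_i x ord0 i ^+ 2)%R.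

(* As is customary for self-similar systems, similarities are taken with respect
   to the Euclidean distance (every similarity of the sup norm is one). *)
Definition contracting_similarity (f : V -> V) :=
  exists2 k : R, (0 < k < 1)%R &
    forall x y, euclidean_norm (f x - f y) = (k * euclidean_norm (x - y))%R.

Definition diam (A : set V) : R :=
  sup [set `|xy.1 - xy.2|%R | xy in A `*` A].

Definition ball_pow (x : V) (r delta : R) : set V := closed_ball x (r `^ delta).

End metric.

Section self_similar.
Context {R : realType} {d m : nat}.
Local Notation V := 'rV[R]_d.

Definition is_attractor (f : 'I_m -> V -> V) (K : set V) :=
  [/\ K !=set0, compact K & K = \bigcup_(i in [set: 'I_m]) (f i @` K)].

Definition probability_vector (p : 'I_m -> R) :=
  (forall i, 0 < p i < 1)%R /\ (\sum_i p i)%R = 1%R.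

Definition is_self_similar_measure (f : 'I_m -> V -> V) (p : 'I_m -> R)
    (mu : probability (borel_rV R d) R) :=
  forall A : set (borel_rV R d), measurable A ->
    mu A = \sum_i (p i)%:E * mu (f i @^-1` A).

End self_similar.

Section hausdorff.
Context {R : realType} {d : nat}.
Local Notation V := 'rV[R]_d.

(* Infimum of the sums of zeta(|L_n|) over the at most countable covers of E by
   closed balls L_n (of positive radius) with |L_n| <= t.  Finite covers are
   allowed; this matters for the exponent s = 0. *)
Definition hausdorff_pre (zeta : R -> R) (t : \bar R) (E : set V) : \bar R :=
  ereal_inf [set v | exists (D : set nat) (x : nat -> V) (r : nat -> R),
    [/\ forall n, D n -> (0 < r n)%R,
        forall n, D n -> (diam (closed_ball (x n) (r n)))%:E <= t,
        E `<=` \bigcup_(n in D) closed_ball (x n) (r n) &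
        v = \esum_(n in D) (zeta (diam (closed_ball (x n) (r n))))%:E]].

Definition hausdorff_measure (zeta : R -> R) (E : set V) : \bar R :=
  lim (hausdorff_pre zeta t%:E E @[t --> (0:R)^'+]).

Definition hausdorff_content (s : R) (E : set V) : \bar R :=
  hausdorff_pre (fun t => t `^ s)%R +oo E.

Definition hausdorff_dim (E : set V) : \bar R :=
  ereal_inf [set s%:E | s in [set s : R |
    (0 <= s)%R /\ hausdorff_measure (fun t => t `^ s)%R E = 0]].

(* Only the values of zeta on [0, +oo[ are meaningful.  As in the source,
   continuity of zeta is not required. *)
Definition gauge (zeta : R -> R) :=
  [/\ forall t, (0 <= t)%R -> (0 <= zeta t)%R,
      zeta 0%R = 0%R &
      exists2 eta : R, (0 < eta)%R &
        {in `[0, eta]%R &, {homo zeta : t u / (t < u)%R}}].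

End hausdorff.

Section measures.
Context {R : realType} {d : nat}.
Local Notation V := 'rV[R]_d.
Variable mu : probability (borel_rV R d) R.

(* log mu(B(x,r)) / log r, with log 0 = -oo *)
Definition local_exponent (x : V) (r : R) : \bar R :=
  lne (mu (closed_ball x r)) / (ln r)%:E.

Definition lower_hausdorff_dim : \bar R :=
  ess_inf mu (fun x => limf_einf (local_exponent x) (0:R)^'+).

(* When mu is exact dimensional (as self-similar measures are), its lower
   Hausdorff and upper packing dimensions coincide, so that the common value is
   the lower one. *)
Definition dim_measure : \bar R := lower_hausdorff_dim.

Definition measure_support : set V :=
  [set x | forall U : set V, open U -> U x -> 0 < mu U].

Definition doubling :=
  exists2 C : R, (0 < C)%R & forall (x : V) (r : R),
    measure_support x -> (0 < r)%R ->
    mu (closed_ball x (2 * r)) <= C%:E * mu (closed_ball x r).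

(* The subfamily (B_n)_{n in N} is mu-a.c. *)
Definition asymptotically_covering (B : nat -> set V) (N : set nat) :=
  exists2 C : R, (0 < C)%R & forall (Omega : set V) (g : nat), open Omega ->
    exists I : set nat,
      [/\ finite_set I,
          forall n, I n -> [/\ N n, (g <= n)%N & B n `<=` Omega],
          trivIset I B &
          C%:E * mu Omega <= mu (\bigcup_(n in I) B n)].

Definition essential_content (s : R) (A : set V) : \bar R :=
  ereal_inf [set hausdorff_content s E | E in
    [set E : set (borel_rV R d) | [/\ measurable E, E `<=` A & mu E = mu A]]].

Definition s_pair (B U : set V) : \bar R :=
  ereal_sup [set s%:E | s in [set s : R |
    (0 <= s)%R /\ mu B <= essential_content s U]].

Definition N_index (B U : nat -> set V) (s : R) : set nat :=
  [set n | s%:E <= s_pair (B n) (U n)].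

(* ereal_sup set0 = -oo *)
Definition s_exponent (B U : nat -> set V) : \bar R :=
  ereal_sup [set s%:E | s in [set s : R |
    (0 <= s)%R /\ asymptotically_covering B (N_index B U s)]].

(* B_n = B(x n, r n); used only when the lower Hausdorff dimension of mu is
   positive and eps is small. *)
Definition t_eps (delta : R) (x : nat -> V) (r : nat -> R) (eps : R) : \bar R :=
  limn_esup (fun n =>
    lne (essential_content (fine lower_hausdorff_dim - eps)
           (ball_pow (x n) (r n) delta)°)
    / (ln (diam (ball_pow (x n) (r n) delta)))%:E).

Definition t_exponent (delta : R) (x : nat -> V) (r : nat -> R) : \bar R :=
  lim (t_eps delta x r eps @[eps --> (0:R)^'+]).

(* The lower bound on the Hausdorff dimension of limsup of the interiors of the
   B_n^delta. *)
Definition dim_lower_bound (delta : R) (x : nat -> V) (r : nat -> R) :=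
  dim_measure / delta%:E
    <= hausdorff_dim (lim_sup_set (fun n => (ball_pow (x n) (r n) delta)°)).

Definition gauge_lower_bound (delta : R) (x : nat -> V) (r : nat -> R) :=
  exists zeta : R -> R,
    [/\ gauge zeta,
        exists2 l : R, (ln (zeta t) / ln t)%R @[t --> (0:R)^'+] --> l
                     & dim_measure / delta%:E <= l%:E &
        0 < hausdorff_measure zeta
              (lim_sup_set (fun n => (ball_pow (x n) (r n) delta)°))].

(* The bound on t_exponent is guarded because t_exponent is only meaningful when
   the dimension of mu is positive; that its defining limit exists is part of
   the assertion, as lim returns an unspecified value otherwise. *)
Definition ubiquity_conclusions (delta : R) (x : nat -> V) (r : nat -> R) :=
  [/\ 0 < lower_hausdorff_dim ->
        cvg (t_eps delta x r eps @[eps --> (0:R)^'+]) /\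
        t_exponent delta x r <= dim_measure,
      dim_measure / delta%:E
        <= s_exponent (fun n => closed_ball (x n) (r n))
                      (fun n => (ball_pow (x n) (r n) delta)°),
      gauge_lower_bound delta x r &
      dim_lower_bound delta x r].

End measures.

(* Main.v *)
(* Every small ball U centred on K contains the image of K under a cylinder map of comparable
   ratio, and mu dominates a positive multiple of the image of mu under this map.  Hence U carries
   measures absolutely continuous with respect to mu that satisfy a Frostman bound of any exponent
   s < dim mu with constants independent of U.  This bounds the essential content of U from below
   by a multiple of |U|^s, which yields the statements on the exponents t and s; it also allows one
   to build a tree of balls B_n^delta whose children are chosen, by asymptotic covering, among
   tiny disjoint B_n that carry at least half of the Frostman measure of their parent.  The mass
   distribution, with exponents s increasing to dim mu along the generations, gives the gauge.
   If only mu (limsup B_n) = 1 is known, the polynomial lower bound for the mass of balls centred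
   on K provides a radius between r_n and r_n^(1 - eps) at which mu is doubling, and Vitali's
   covering lemma shows that the balls with these radii are asymptotically covering. *)

Require Import Defs.
From HB Require Import structures.
From mathcomp Require Import all_boot all_order all_algebra.
From mathcomp Require Import all_classical all_reals all_analysis.
From mathcomp Require Import ess_sup_inf ring lra zify.

Import Order.TTheory GRing.Theory Num.Theory.
Import numFieldNormedType.Exports.

Local Open Scope classical_set_scope.
Local Open Scope ring_scope.

(** * Balls for the sup norm *)

Section geometry.
Context {R : realType} {d : nat}.
Local Notation V := 'rV[R]_d.
Implicit Types (x y z : V) (r s : R).

(** Cylinders may overlap, so their mass is never computed. The inequality [q * mu (g^-1 A) <= mu A]
    suffices: it sends null sets to null sets, and sets of mass at most [q * tau] to sets of mass at
    most [tau]. No limit measure is built on the tree. Averages over finite generations replace it,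
    and compactness yields finitely many balls of the cover that contain a whole finite generation.
    The price is an error of order [4^-j] per covering ball, harmless thanks to a bound 1/4 on the
    transition weights. The Frostman constants are not controlled as [s] tends to the dimension.
    They are absorbed one generation at a time by the gap between the Frostman exponent divided by
    [delta] and the next gauge exponent, once the radii of the children are small enough in terms of
    these constants. In dimension 0 there is no exponent [s] below the dimension, and that case has
    its own arguments: the content of exponent 0 counts balls, and a discontinuous gauge charges
    points. *)

Lemma closed_ballP x r y : 0 < r -> closed_ball x r y <-> `|x - y| <= r.
Proof. by move=> r0; rewrite closed_ballE. Qed.

Lemma ballP x r y : ball x r y <-> `|x - y| < r.
Proof. by rewrite -ball_normE. Qed.

Lemma closed_ball_center x r : 0 < r -> closed_ball x r x.
Proof. by move=> r0; apply/closed_ballP => //; rewrite subrr normr0 ltW. Qed.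

Lemma diam_closed_ball x r : (0 < d)%N -> 0 < r -> diam (closed_ball x r) = 2 * r.
Proof.
move=> d0 r0; rewrite /diam.
set S := [set _ | _ in _].
have ubS : ubound S (2 * r).
  move=> _ [[y z] /= [/closed_ballP-/(_ r0) xy /closed_ballP-/(_ r0) xz] <-].
  rewrite -(subrKA x) [2 * r](_ : _ = r + r); last by ring.
  by rewrite (le_trans (ler_normD _ _))// lerD// distrC.
pose u : V := const_mx r.
have un : `|u| = r.
  apply/eqP; rewrite eq_le; apply/andP; split.
    rewrite [leLHS]/Num.norm/= mx_normrE; apply/bigmax_leP; split; first exact: ltW.
    by move=> i _; rewrite mxE ger0_norm// ltW.
  rewrite [leRHS]/Num.norm/= mx_normrE; apply/bigmax_geP; right => /=.
  by exists (ord0, Ordinal d0) => //; rewrite mxE ger0_norm// ltW.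
have Su : S (2 * r).
  exists (x + u, x - u) => /=; last first.
    by rewrite opprD opprK addrACA subrr add0r -mulr2n normrMn un mulr_natl.
  split; apply/closed_ballP => //.
    by rewrite opprD addrA subrr add0r normrN un.
  by rewrite subKr un.
apply/eqP; rewrite eq_le; apply/andP; split.
  by apply: ge_sup => //; exists (2 * r).
by apply: ub_le_sup => //; exists (2 * r).
Qed.

(** If the centres were at distance at most [r + s], the point dividing the segment from [x] to [y]
    in the ratio [r : s] would lie in both balls. *)
Lemma disjoint_closed_balls x r y s : 0 < r -> 0 < s ->
  closed_ball x r `&` closed_ball y s = set0 -> r + s < `|x - y|.
Proof.
move=> r0 s0 xy0; rewrite ltNge; apply/negP => xy.
have rs0 : 0 < r + s by rewrite addr_gt0.
have rsN0 : r + s != 0 by rewrite gt_eqF.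
pose t := r / (r + s).
have t0 : 0 <= t by rewrite divr_ge0 ?ltW.
have t1 : 0 <= 1 - t by rewrite subr_ge0 ler_pdivrMr// mul1r lerDl ltW.
suff : (closed_ball x r `&` closed_ball y s) (x - t *: (x - y)) by rewrite xy0.
split; apply/closed_ballP => //.
  rewrite subKr normrZ ger0_norm// (le_trans (ler_wpM2l t0 xy))//.
  by rewrite divfK.
have -> : y - (x - t *: (x - y)) = - ((1 - t) *: (x - y)).
  by rewrite scalerBl scale1r !opprB addrCA.
rewrite normrN normrZ ger0_norm// (le_trans (ler_wpM2l t1 xy))//.
by rewrite mulrBl mul1r divfK// addrAC subrr add0r.
Qed.

Lemma closed_ball_sub x r y s : 0 < r -> 0 < s ->
  `|x - y| + r <= s -> closed_ball x r `<=` closed_ball y s.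
Proof.
move=> r0 s0 xys z /closed_ballP-/(_ r0) xz; apply/closed_ballP => //.
rewrite (le_trans _ xys)// -(subrKA x) (le_trans (ler_normD _ _))//.
by rewrite distrC lerD.
Qed.

Lemma closed_ball_sub_ball x r y s : 0 < r ->
  `|x - y| + r < s -> closed_ball x r `<=` ball y s.
Proof.
move=> r0 xys z /closed_ballP-/(_ r0) xz; apply/ballP.
rewrite (le_lt_trans _ xys)// -(subrKA x) (le_trans (ler_normD _ _))//.
by rewrite distrC lerD.
Qed.

(* Greedy choice of the largest remaining ball. *)
Lemma vitali_finite (x : nat -> V) (r : nat -> R) (s : seq nat) :
  (forall n, 0 < r n) ->
  exists t : seq nat, [/\ uniq t, {subset t <= s},
    (forall i j, i \in t -> j \in t -> i != j ->
       closed_ball (x i) (r i) `&` closed_ball (x j) (r j) = set0) &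
    (forall i, i \in s -> exists2 j, j \in t &
       `|x i - x j| <= r i + r j /\ r i <= r j)].
Proof.
move=> r0; have [n] := ubnP (size s); elim: n s => // n IH s sn.
have [->|s0] := eqVneq s [::]; first by exists [::].
have [j js jmax] : exists2 j, j \in s & forall i, i \in s -> r i <= r j.
  case: s s0 {sn} => // a s _; elim: s a => [|b s ih] a.
    by exists a; rewrite ?inE// => i; rewrite inE => /eqP->.
  have [j jb jm] := ih b; have [ja|aj] := leP (r j) (r a).
    exists a; first by rewrite inE eqxx.
    move=> i; rewrite inE => /orP[/eqP->//|/jm/le_trans]; exact.
  exists j; first by rewrite inE jb orbT.
  by move=> i; rewrite inE => /orP[/eqP->//|/jm//]; exact: ltW.
pose s' := [seq i <- s | ~~ (`|x i - x j| <= r i + r j)].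
have s's : (size s' < n)%N.
  rewrite -ltnS (leq_trans _ sn)// ltnS size_filter -[X in (_ < X)%N](count_predC (fun i => `|x i - x j| <= r i + r j)).
  rewrite -[X in (X < _)%N]add0n ltn_add2r -has_count; apply/hasP; exists j => //=.
  by rewrite subrr normr0 addr_ge0// ltW.
have [t [ut ts tdis tcov]] := IH _ s's.
have tj i : i \in t -> r i + r j < `|x i - x j|.
  by move=> /ts; rewrite mem_filter -ltNge => /andP[].
have far i k : r i + r k < `|x i - x k| ->
    closed_ball (x i) (r i) `&` closed_ball (x k) (r k) = set0.
  move=> ik; apply/seteqP; split => // z [/closed_ballP-/(_ (r0 _)) zi].
  move=> /closed_ballP-/(_ (r0 _)) zk; move: ik.
  rewrite ltNge -(subrKA z) (le_trans (ler_normD _ _))// lerD//.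
  by rewrite distrC.
exists (j :: t); split.
- rewrite /= ut andbT; apply/negP => /tj; rewrite subrr normr0 ltNge.
  by rewrite addr_ge0// ltW.
- by move=> i; rewrite inE => /orP[/eqP->//|/ts]; rewrite mem_filter => /andP[].
- move=> i k; rewrite !inE => /orP[/eqP->|it] /orP[/eqP->|kt]; rewrite ?eqxx//.
  + by move=> _; rewrite setIC far// tj.
  + by move=> _; rewrite far// tj.
  + exact: tdis.
- move=> i si; have [ij|ij] := leP `|x i - x j| (r i + r j).
    by exists j; rewrite ?inE ?eqxx//; split => //; exact: jmax.
  have [|k kt ik] := tcov i; first by rewrite mem_filter si andbT -ltNge.
  by exists k => //; rewrite inE kt orbT.
Qed.

Lemma mx_entry_norm x i : `|x ord0 i| <= `|x|.
Proof.
rewrite [leRHS]/Num.norm/= mx_normrE; apply/bigmax_geP; right => /=.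
by exists (ord0, i).
Qed.

Lemma norm_le_euclidean x : `|x| <= euclidean_norm x.
Proof.
rewrite [leLHS]/Num.norm/= mx_normrE; apply/bigmax_leP; split; first exact: sqrtr_ge0.
move=> [i j] _; rewrite ord1/= -sqrtr_sqr ler_wsqrtr// (bigD1 j)//= lerDl.
by apply: sumr_ge0 => k _; rewrite sqr_ge0.
Qed.

Lemma euclidean_le_norm x : euclidean_norm x <= Num.sqrt d%:R * `|x|.
Proof.
rewrite -[X in _ * X](ger0_norm (normr_ge0 _)) -sqrtr_sqr -sqrtrM// ler_wsqrtr//.
rewrite (le_trans (ler_sum _ (_ : forall i, true -> x ord0 i ^+ 2 <= `|x| ^+ 2)))//.
  by move=> i _; rewrite -[leLHS]real_normK ?num_real// lerXn2r ?nnegrE ?mx_entry_norm.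
by rewrite sumr_const card_ord mulr_natl.
Qed.

Lemma euclidean_norm_ge0 x : 0 <= euclidean_norm x.
Proof. exact: sqrtr_ge0. Qed.

Lemma continuous_euclidean_norm : continuous (@euclidean_norm R d).
Proof.
move=> x; apply: (@continuous_comp _ _ _ (fun y : V => \sum_i y ord0 i ^+ 2) Num.sqrt);
  last exact: sqrt_continuous.
have : continuous (fun y : V => \sum_(i < d) y ord0 i ^+ 2).
  have -> : (fun y : V => \sum_(i < d) y ord0 i ^+ 2) = \sum_(i < d) (fun y : V => y ord0 i ^+ 2).
    by apply/funext => y; rewrite fct_sumE.
  elim/big_ind : _ => [|f g cf cg|i _].
  - exact: cst_continuous.
  - by move=> y; apply: continuousD; [exact: cf|exact: cg].
  - move=> y; apply: (@continuous_comp _ _ _ (fun y : V => y ord0 i) (fun t => t ^+ 2)).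
      exact: coord_continuous.
    exact: exprn_continuous.
exact.
Qed.

End geometry.

(** * Borel sets and self-similar measures *)

Definition borel {R : realType} {d : nat} (A : set 'rV[R]_d) : Prop :=
  measurable (A : set (borel_rV R d)).

Definition mass {R : realType} {d : nat} (mu : probability (borel_rV R d) R)
  (A : set 'rV[R]_d) : R := fine (mu A).

Section borel_sets.
Context {R : realType} {d : nat}.
Local Notation V := 'rV[R]_d.
Implicit Types (A B : set V) (g : V -> V).

Lemma borel_open A : open A -> borel A.
Proof. by move=> oA; exact: sub_sigma_algebra. Qed.

Lemma borel_setC A : borel A -> borel (~` A).
Proof. exact: measurableC. Qed.

Lemma borel_closed A : closed A -> borel A.
Proof. by move=> cA; rewrite -[A]setCK; apply: borel_setC; apply: borel_open; exact: closed_openC. Qed.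

Lemma borel_setI A B : borel A -> borel B -> borel (A `&` B).
Proof. exact: measurableI. Qed.

Lemma borel_setU A B : borel A -> borel B -> borel (A `|` B).
Proof. exact: measurableU. Qed.

Lemma borel_setD A B : borel A -> borel B -> borel (A `\` B).
Proof. exact: measurableD. Qed.

Lemma borel_bigcup (F : nat -> set V) (D : set nat) :
  (forall n, D n -> borel (F n)) -> borel (\bigcup_(n in D) F n).
Proof. by move=> bF; exact: (@bigcup_measurable _ (borel_rV R d)). Qed.

Lemma borel_closed_ball (x : V) (r : R) : borel (closed_ball x r).
Proof. by apply: borel_closed; exact: closed_ball_closed. Qed.

Lemma borel_ball (x : V) (r : R) : borel (ball x r).
Proof. by apply: borel_open; exact: ball_open. Qed.

Lemma borel_preimage g A : continuous g -> borel A -> borel (g @^-1` A).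
Proof.
move=> cg bA; rewrite /borel -[X in measurable X]setTI.
have : measurable_fun [set: borel_rV R d] (g : borel_rV R d -> borel_rV R d).
  apply: (@measurability _ _ (borel_rV R d) (borel_rV R d) setT g (@open V)) => //.
  move=> _ [B oB <-]; rewrite setTI; apply: borel_open.
  by move/continuousP : cg; exact.
by move=> mg; exact: mg.
Qed.

End borel_sets.

Section mass_theory.
Context {R : realType} {d : nat}.
Local Notation V := 'rV[R]_d.
Variable mu : probability (borel_rV R d) R.
Implicit Types (A B : set V).
Local Notation P := (mass mu).

Lemma massE A : borel A -> mu A = (P A)%:E.
Proof. by move=> mA; rewrite /mass fineK// fin_num_measure. Qed.

Lemma mass_ge0 A : 0 <= P A.
Proof. exact/fine_ge0/measure_ge0. Qed.

Lemma mass_setT : P [set: V] = 1.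
Proof. by rewrite /mass (@probability_setT _ _ _ mu). Qed.

Lemma mass_set0 : P set0 = 0.
Proof. by rewrite /mass measure0. Qed.

Lemma le_mass A B : borel A -> borel B -> A `<=` B -> P A <= P B.
Proof. by move=> mA mB AB; rewrite -lee_fin -!massE// le_measure ?inE. Qed.

Lemma mass_le1 A : borel A -> P A <= 1.
Proof. by move=> mA; rewrite -mass_setT le_mass//; exact: measurableT. Qed.

Lemma massU A B : borel A -> borel B -> A `&` B = set0 -> P (A `|` B) = P A + P B.
Proof.
move=> mA mB AB; apply: EFin_inj; rewrite EFinD -!massE//; last exact: borel_setU.
by rewrite measureU//; apply/eqP/negPn.
Qed.

Lemma massC A : borel A -> P (~` A) = 1 - P A.
Proof.
move=> mA; apply/eqP; rewrite eq_sym subr_eq -massU ?setUCl ?mass_setT//.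
  exact: borel_setC.
by rewrite setICl.
Qed.

Lemma massD A B : borel A -> borel B -> P (A `\` B) = P A - P (A `&` B).
Proof.
move=> mA mB; apply/eqP; rewrite eq_sym subr_eq -massU.
- by rewrite setUC setUIDK.
- exact: borel_setD.
- exact: borel_setI.
- by apply/seteqP; split => // x [[_ nB] [_ /nB]].
Qed.

Lemma mass_subU A B : borel A -> borel B -> P (A `|` B) <= P A + P B.
Proof.
move=> mA mB; rewrite -lee_fin EFinD -!massE//; last exact: borel_setU.
exact: measureU2.
Qed.

Lemma mass_bigcup_ge (F : nat -> set V) (b : R) :
  (forall n, borel (F n)) -> (forall n, F n `<=` F n.+1) ->
  b < P (\bigcup_n F n) -> exists n, b < P (F n).
Proof.
move=> mF Fn bF.
have ndF : {homo F : n m / (n <= m)%N >-> (n <= m)%O}.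
  apply: (homo_leq (r := fun A B : set V => (A <= B)%O)) => //=; [exact: le_trans|by move=> n; apply/subsetPset].
have : mu \o F @ \oo --> mu (\bigcup_n F n).
  by apply: nondecreasing_cvg_mu => //; apply: borel_bigcup.
move=> cF; apply: contrapT => /forallNP H.
suff : (mu (\bigcup_n F n) <= b%:E)%E.
  rewrite massE; last exact: borel_bigcup.
  by rewrite lee_fin leNgt bF.
rewrite -(cvg_lim _ cF)//; apply: lime_le; first by apply/cvgP: cF.
by apply: nearW => n /=; rewrite massE// lee_fin leNgt; exact/negP/H.
Qed.

Lemma mass_bigcap1 (F : nat -> set V) : (forall n, borel (F n)) ->
  (forall n, F n.+1 `<=` F n) ->
  (forall n, P (F n) = 1) -> P (\bigcap_n F n) = 1.
Proof.
move=> mF dF F1.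
have mI : borel (\bigcap_n F n).
  by rewrite -[X in borel X]setCK setC_bigcap; apply: borel_setC;
    apply: borel_bigcup => n _; exact: borel_setC.
apply/eqP; rewrite eq_le mass_le1//= leNgt -subr_gt0 -massC// setC_bigcap.
apply/negP => /mass_bigcup_ge[n|n|n]; first exact: borel_setC.
  exact: subsetC.
by rewrite massC// F1 subrr ltxx.
Qed.

Lemma mass1I A B : borel A -> borel B -> P A = 1 -> P (A `&` B) = P B.
Proof.
move=> mA mB A1; apply/eqP; rewrite eq_le le_mass//=; last exact: borel_setI.
have := massD _ _ mB mA; rewrite setIC => /eqP; rewrite eq_sym subr_eq => /eqP ->.
rewrite addrC -[leRHS]addr0 lerD2l.
rewrite (le_trans (le_mass _ (~` A) _ _ _))//.
- exact: borel_setD.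
- exact: borel_setC.
- by rewrite massC// A1 subrr.
Qed.

End mass_theory.

Lemma exists_expr_lt {R : realType} (k e : R) : 0 <= k < 1 -> 0 < e ->
  exists n : nat, k ^+ n < e.
Proof.
move=> /andP[k0 k1] e0.
have /cvgrPdist_lt/(_ _ e0) : k ^+ n @[n --> \oo] --> (0 : R).
  by apply: cvg_expr; rewrite ger0_norm.
move=> [n _ /(_ n (leqnn n))]; rewrite /= sub0r normrN ger0_norm ?exprn_ge0// => ?.
by exists n.
Qed.

Lemma exists_natinv_lt {R : realType} (e : R) : 0 < e ->
  exists n : nat, n.+1%:R^-1 < e.
Proof.
move=> e0; have [n _ /(_ n (leqnn n))] := near_infty_natSinv_lt (PosNum e0).
by exists n.
Qed.

(** * Self-similar measures are carried by the attractor *)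

Section self_similar.
Context {R : realType} {d m : nat}.
Local Notation V := 'rV[R]_d.
Variables (f : 'I_m -> V -> V) (p : 'I_m -> R) (K : set V).
Variable (mu : probability (borel_rV R d) R).
Hypotheses (hm : (2 <= m)%N) (hf : forall i, contracting_similarity (f i)).
Hypotheses (hK : is_attractor f K) (hp : probability_vector p).
Hypothesis hmu : is_self_similar_measure f p mu.
Local Notation P := (mass mu).

(* A real exponent h with [k i `^ h <= p i] for all i turns the ratio of a cylinder into a
   lower bound for its mass. *)
Lemma similarity_ratios : exists (k : 'I_m -> R) (kmin kmax h : R),
  [/\ 0 < kmin, kmax < 1, 0 <= h, (forall i, kmin <= k i <= kmax /\ k i `^ h <= p i) &
     forall i x y, euclidean_norm (f i x - f i y) = k i * euclidean_norm (x - y)].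
Proof.
have /choice[k hk] i : exists k : R, 0 < k < 1 /\
    forall x y, euclidean_norm (f i x - f i y) = k * euclidean_norm (x - y).
  by have [k k01 kP] := hf i; exists k.
have i0 : 'I_m := Ordinal (ltnW hm).
pose kmin := \big[Num.min/1]_i k i; pose kmax := \big[Num.max/0]_i k i.
pose pmin := \big[Num.min/1]_i p i.
have kmin0 : 0 < kmin.
  by apply/bigmin_gtP; split => // i _; case: (hk i) => /andP[].
have pmin0 : 0 < pmin.
  by apply/bigmin_gtP; split => // i _; case: hp => /(_ i)/andP[].
have kmax1 : kmax < 1.
  by apply/bigmax_ltP; split => // i _; case: (hk i) => /andP[].
have kle i : kmin <= k i <= kmax.
  by rewrite bigmin_le_cond//= le_bigmax_cond.
have kmax0 : 0 < kmax.
  by have /andP[h1 h2] := kle i0; rewrite (lt_le_trans kmin0)// (le_trans h1).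
have pmin1 : pmin <= 1 by exact: bigmin_le_id.
have lk : ln kmax < 0 by rewrite ln_lt0// kmax0.
(* This exponent satisfies [kmax ^ h = pmin], so it serves the least favourable ratio and weight at
   once. *)
exists k, kmin, kmax, (ln pmin / ln kmax); split => //.
- by rewrite mulr_le0//; [rewrite ln_le0|rewrite invr_le0 ltW].
- move=> i; split => //; rewrite (@le_trans _ _ (kmax `^ (ln pmin / ln kmax)))//.
    rewrite ge0_ler_powR ?nnegrE//.
    + by rewrite mulr_le0//; [rewrite ln_le0|rewrite invr_le0 ltW].
    + by have [/andP[/ltW]] := hk i.
    + exact: ltW.
    + by have /andP[] := kle i.
  rewrite /powR gt_eqF// divfK ?lt_eqF// lnK ?posrE//.
  by rewrite bigmin_le_cond.
- by move=> i; have [_] := hk i.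
Qed.

Lemma similarity_continuous (g : V -> V) (k : R) : 0 < k ->
  (forall x y, euclidean_norm (g x - g y) = k * euclidean_norm (x - y)) ->
  continuous g.
Proof.
move=> k0 gk x; apply/(cvgrPdist_lt (F := nbhs x)) => e e0.
pose c := k * Num.sqrt d%:R + 1.
have c0 : 0 < c by rewrite ltr_wpDl// mulr_ge0// ?sqrtr_ge0// ltW.
near=> y; rewrite (le_lt_trans (norm_le_euclidean _))// gk.
rewrite (@le_lt_trans _ _ (c * `|x - y|))//.
  rewrite (le_trans (ler_wpM2l (ltW k0) (euclidean_le_norm _)))// mulrA ler_wpM2r//.
  by rewrite lerDl.
rewrite mulrC -ltr_pdivlMr//; near: y.
by apply/nbhs_ballP; exists (e / c); rewrite /= ?divr_gt0// => z /ballP.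
Unshelve. all: by end_near. Qed.

Lemma ifs_continuous i : continuous (f i).
Proof.
have [k /andP[k0 _] fk] := hf i.
exact: (similarity_continuous _ k).
Qed.

Lemma mass_self_similar A : borel A -> P A = \sum_i p i * P (f i @^-1` A).
Proof.
move=> mA; apply: EFin_inj; rewrite -massE// hmu// -sumEFin.
apply: eq_bigr => i _; rewrite EFinM massE//.
by apply: borel_preimage => //; exact: ifs_continuous.
Qed.

Lemma ifs_sub_attractor i : f i @` K `<=` K.
Proof. by move=> y fy; case: hK => _ _ ->; exists i. Qed.

Lemma attractor_closed : closed K.
Proof. by apply: compact_closed; [exact: norm_hausdorff|case: hK]. Qed.

Lemma borel_attractor : borel K.
Proof. exact: borel_closed attractor_closed. Qed.

(** Taken in the Euclidean norm, the one that the maps scale exactly. *)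
Let nbh (rho : R) : set V :=
  [set y | exists2 z, K z & euclidean_norm (y - z) < rho].

Let open_nbh rho : open (nbh rho).
Proof.
rewrite (_ : nbh rho = \bigcup_(z in K) [set y | euclidean_norm (y - z) < rho]).
  apply: bigcup_open => z _.
  have /continuousP : continuous (fun y : V => euclidean_norm (y - z)).
    move=> y; apply: (@continuous_comp _ _ _ (fun y : V => y - z) (@euclidean_norm R d)).
      by apply: continuousB; [exact: id|exact: cst_continuous].
    exact: continuous_euclidean_norm.
  by move=> /(_ _ (open_lt (y := rho))).
by apply/seteqP; split => [y [z]|y [z]]; exists z.
Qed.

(** Each [f i] maps the [s / kmax] neighbourhood of [K] into its [s] neighbourhood, so by
    self-similarity the mass of the latter dominates that of the former. Iterated, this compares
    [nbh rho] with neighbourhoods that exhaust the space. *)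
Let mass_nbh rho : 0 < rho -> P (nbh rho) = 1.
Proof.
move=> rho0.
have [k [kmin [kmax [h [kmin0 kmax1 h0 kP fk]]]]] := similarity_ratios.
have kmax0 : 0 < kmax.
  have /andP[h1 h2] := (kP (Ordinal (ltnW hm))).1.
  by rewrite (lt_le_trans kmin0)// (le_trans h1).
have step s : 0 < s -> P (nbh (s / kmax)) <= P (nbh s).
  move=> s0; rewrite [leRHS]mass_self_similar; last exact: borel_open.
  rewrite -[leLHS]mul1r -hp.2 mulr_suml; apply: ler_sum => i _.
  have [/andP[ki kj] _] := kP i.
  rewrite ler_wpM2l//; first by case: hp => /(_ i)/andP[/ltW].
  apply: le_mass; [exact: borel_open|apply: borel_preimage; [exact: ifs_continuous|exact: borel_open]|].
  move=> y [z Kz yz]; exists (f i z).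
    by apply: (ifs_sub_attractor i); exists z.
  rewrite fk (le_lt_trans (ler_wpM2r (euclidean_norm_ge0 _) kj))//.
  by rewrite mulrC -ltr_pdivlMr.
have steps n : P (nbh (rho / kmax ^+ n)) <= P (nbh rho).
  elim: n => [|n IH]; first by rewrite expr0 divr1.
  rewrite (le_trans _ IH)// exprS invfM mulrCA mulrC step//.
  by rewrite divr_gt0// exprn_gt0.
have cup : \bigcup_n nbh (rho / kmax ^+ n) = setT.
  apply/seteqP; split => // y _.
  have [[z Kz] _ _] := hK.
  have [n] : exists n : nat, kmax ^+ n < rho / (euclidean_norm (y - z) + 1).
    apply: exists_expr_lt; first by rewrite ltW.
    by rewrite divr_gt0// ltr_wpDl// euclidean_norm_ge0.
  have e0 : 0 < euclidean_norm (y - z) + 1.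
    by rewrite ltr_wpDl// euclidean_norm_ge0.
  rewrite ltr_pdivlMr// mulrC -ltr_pdivlMr ?exprn_gt0// => yz.
  by exists n => //; exists z => //; rewrite (lt_trans _ yz)// ltrDl.
apply/eqP; rewrite eq_le mass_le1/=; last exact: borel_open.
rewrite leNgt; apply/negP => lt1.
case: (@mass_bigcup_ge _ _ mu (fun n => nbh (rho / kmax ^+ n)) (P (nbh rho))) => [n|n y||n].
- exact: borel_open.
- move=> [z Kz yz]; exists z => //; rewrite (lt_le_trans yz)//.
  rewrite ler_wpM2l ?(ltW rho0)// lef_pV2 ?posrE ?exprn_gt0//.
  by rewrite exprS ler_piMl ?exprn_ge0// ltW.
- by rewrite cup mass_setT.
- by rewrite ltNge steps.
Qed.

Lemma mass_attractor : P K = 1.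
Proof.
rewrite (_ : K = \bigcap_n nbh n.+1%:R^-1).
  apply: mass_bigcap1 => [n|n y [z Kz yz]|n].
  - exact: borel_open.
  - exists z => //; rewrite (lt_le_trans yz)//.
    by rewrite lef_pV2 ?posrE// ler_nat.
  - by rewrite mass_nbh.
apply/seteqP; split => [y Ky n _|y Hy].
  exists y => //; rewrite subrr (le_lt_trans (euclidean_le_norm _))//.
  by rewrite normr0 mulr0.
have := attractor_closed; rewrite closure_id => ->.
move=> B; rewrite -nbhs_ballE => -[e /= e0 eB].
have [n ne] := exists_natinv_lt _ e0.
have [z Kz yz] := Hy n I.
exists z; split => //; apply: eB; apply/ballP.
by rewrite (le_lt_trans (norm_le_euclidean _))// (lt_trans yz).
Qed.

End self_similar.

(* A cylinder map [f_w] with its ratio [k] and its weight [q = p_w]. *)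
Definition is_cylinder {R : realType} {d : nat} (mu : probability (borel_rV R d) R)
    (h : R) (g : 'rV[R]_d -> 'rV[R]_d) (k q : R) :=
  [/\ 0 < k, k `^ h <= q,
     forall x y, euclidean_norm (g x - g y) = k * euclidean_norm (x - y) &
     forall A, borel A -> q * mass mu (g @^-1` A) <= mass mu A].

(** * Cylinders inside small balls *)

Section cylinders.
Context {R : realType} {d m : nat}.
Local Notation V := 'rV[R]_d.
Variables (f : 'I_m -> V -> V) (p : 'I_m -> R) (K : set V).
Variable (mu : probability (borel_rV R d) R).
Hypotheses (hm : (2 <= m)%N) (hf : forall i, contracting_similarity (f i)).
Hypotheses (hK : is_attractor f K) (hp : probability_vector p).
Hypothesis hmu : is_self_similar_measure f p mu.
Local Notation P := (mass mu).

Lemma attractor_bounded : exists2 D : R, 1 <= D &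
  forall y z, K y -> K z -> euclidean_norm (y - z) < D.
Proof.
have [_ /compact_bounded [M [_ KM]] _] := hK.
have Kb y : K y -> `|y| <= `|M| + 1.
  by move=> Ky; apply: (KM (`|M| + 1)) => //; rewrite (le_lt_trans (ler_norm _))// ltrDl.
exists (1 + (Num.sqrt d%:R * (2 * (`|M| + 1)) + 1)).
  by rewrite lerDl addr_ge0// mulr_ge0// ?sqrtr_ge0// mulr_ge0// addr_ge0.
move=> y z Ky Kz; rewrite (le_lt_trans (euclidean_le_norm _))//.
rewrite (@le_lt_trans _ _ (Num.sqrt d%:R * (2 * (`|M| + 1))))//.
  rewrite ler_wpM2l ?sqrtr_ge0// (le_trans (ler_normB _ _))//.
  by rewrite mulr_natl mulr2n lerD// Kb.
by rewrite addrCA ltrDl.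
Qed.

(** The word coding [x] is read from its outermost letter: if [x = f i y], a cylinder around [y] at
    scale [r / k i] is composed with [f i], and reading stops once the scale reaches the diameter
    bound [D]. The last letter costs at most a factor [kmin]. The induction is on an [n] with
    [kmax ^ n * D <= r], which bounds the length of the word. *)
Lemma exists_cylinder : exists c h : R, [/\ 0 < c, 0 <= h &
  forall x r, K x -> 0 < r <= 1 -> exists (g : V -> V) (k q : R),
    [/\ is_cylinder mu h g k q, c * r <= k & g @` K `<=` ball x r]].
Proof.
have [k [kmin [kmax [h [kmin0 kmax1 h0 kP fk]]]]] := similarity_ratios _ _ hm hf hp.
have [D D1 KD] := attractor_bounded.
have D0 : 0 < D by rewrite (lt_le_trans ltr01).
have k0 i : 0 < k i by have [/andP[+ _] _] := kP i; exact: lt_le_trans.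
have kmax0 : 0 < kmax.
  have /andP[_ h2] := (kP (Ordinal (ltnW hm))).1.
  by rewrite (lt_le_trans _ h2).
have ind n : forall x r, K x -> 0 < r -> kmax ^+ n * D <= r ->
    exists (g : V -> V) (kap q : R), [/\ is_cylinder mu h g kap q,
      kap * D <= r, Num.min 1 (kmin * r / D) <= kap & (g @` K) x].
  elim: n => [|n IH] x r Kx r0 nr.
    exists id, 1, 1; split.
    - by split => // [|y z|A mA]; rewrite ?powR1 ?mul1r.
    - by rewrite expr0 in nr.
    - by rewrite ge_min lexx.
    - by exists x.
  have [Dr|rD] := leP D r.
    exists id, 1, 1; split.
    - by split => // [|y z|A mA]; rewrite ?powR1 ?mul1r.
    - by rewrite mul1r.
    - by rewrite ge_min lexx.
    - by exists x.
  have [i _ [y Ky fy]] : (\bigcup_(i in setT) (f i @` K)) x.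
    by case: hK => _ _ <-.
  have [|g [kap [q [[kap0 kapq gsim gmu] gD gmin [z Kz gz]]]]] :=
      IH y (r / k i) Ky (divr_gt0 r0 (k0 i)).
    rewrite ler_pdivlMr// (le_trans _ nr)// exprS mulrC mulrA ler_wpM2r ?(ltW D0)//.
    by rewrite ler_wpM2r ?exprn_ge0 ?(ltW kmax0)//; have [/andP[]] := kP i.
  have [p0 _] : p i >= 0 /\ p i <= 1 by have [/(_ i)/andP[/ltW ? /ltW]] := hp.
  exists (f i \o g), (k i * kap), (p i * q); split.
  - split; first by rewrite mulr_gt0.
    + rewrite powRM ?(ltW (k0 i)) ?(ltW kap0)//.
      by rewrite ler_pM ?powR_ge0//; have [] := kP i.
    + by move=> u v; rewrite /= fk gsim mulrA.
    + move=> A mA; have mfA : borel (f i @^-1` A).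
        by apply: borel_preimage => //; exact: (ifs_continuous _ hf).
      rewrite comp_preimage -mulrA (le_trans (ler_wpM2l p0 (gmu _ mfA)))//.
      rewrite [leRHS](mass_self_similar _ _ _ hf hmu)// (bigD1 i)//= lerDl.
      apply: sumr_ge0 => j _; rewrite mulr_ge0 ?mass_ge0//.
      by have [/(_ j)/andP[/ltW]] := hp.
  - by rewrite -mulrA mulrC -ler_pdivlMr.
  - have [/andP[ki1 ki2] _] := kP i.
    have h1 : kmin * r / D <= kmin.
      by rewrite ler_pdivrMr// ler_wpM2l// ltW.
    rewrite (@le_trans _ _ (kmin * r / D))//; first by rewrite ge_min lexx orbT.
    move: gmin; rewrite ge_min => /orP[gmin|gmin].
      rewrite (le_trans h1)// (le_trans ki1)// -[leLHS]mulr1.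
      by rewrite ler_wpM2l// ltW.
    rewrite (le_trans _ (ler_wpM2l (ltW (k0 i)) gmin))//.
    rewrite [leRHS](_ : _ = kmin * r / D)//.
    by field; rewrite !gt_eqF.
  - by exists z => //=; rewrite gz.
exists (kmin / D), h; split => //; first by rewrite divr_gt0.
move=> x r Kx /andP[r0 r1].
have [n nr] : exists n : nat, kmax ^+ n < r / D.
  by apply: exists_expr_lt; rewrite ?divr_gt0// kmax1 ltW.
have [|g [kap [q [gc gD gmin [z Kz gz]]]]] := ind n x r Kx r0.
  by rewrite -ler_pdivlMr// ltW.
exists g, kap, q; split => //.
  have kk : kmin <= 1.
    have [/andP[ki1 ki2] _] := kP (Ordinal (ltnW hm)).
    by rewrite (le_trans ki1)// (le_trans ki2)// ltW.
  rewrite mulrAC (le_trans _ gmin)// le_min lexx andbT ler_pdivrMr// mul1r.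
  by rewrite (le_trans _ D1)// mulr_ile1// ltW.
move=> _ [y Ky <-]; apply/ballP; rewrite (le_lt_trans (norm_le_euclidean _))//.
have [kap0 _ gsim _] := gc.
by rewrite -gz gsim (lt_le_trans _ gD)// ltr_pM2l// KD.
Qed.

(** A cylinder map into the ball pulls it back to a set containing [K], so the ball has mass at
    least [q >= k ^ h >= (c * r) ^ h]. This bounds the dimension, shows that balls centred on [K]
    are charged, and produces doubling scales. *)
Lemma mass_closed_ball_ge : exists c h : R, [/\ 0 < c, 0 <= h &
  forall x r, K x -> 0 < r <= 1 -> c * r `^ h <= P (closed_ball x r)].
Proof.
have [c [h [c0 h0 cyl]]] := exists_cylinder.
exists (c `^ h), h; split; rewrite ?powR_gt0// => x r Kx r01.
have /andP[r0 r1] := r01.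
have [g [k [q [[k0 kq gsim gmu] ck gK]]]] := cyl x r Kx r01.
rewrite -powRM ?(ltW c0) ?(ltW r0)//.
rewrite (le_trans _ (le_mass _ (ball x r) _ _ _ _))//.
- rewrite (le_trans _ (gmu _ (borel_ball _ _)))//.
  rewrite (_ : P _ = 1).
    rewrite mulr1 (le_trans _ kq)// ge0_ler_powR// nnegrE ?(ltW k0)//.
    by rewrite mulr_ge0// ltW.
  have mg : borel (g @^-1` ball x r).
    apply: borel_preimage; first exact: (similarity_continuous _ _ k0 gsim).
    exact: borel_ball.
  apply/eqP; rewrite eq_le mass_le1//= -(mass_attractor _ _ _ _ hm hf hK hp hmu).
  apply: le_mass => //; first exact: (borel_attractor _ _ hK).
  by move=> y Ky; apply: gK; exists y.
- exact: borel_ball.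
- exact: borel_closed_ball.
- exact: subset_closed_ball.
Qed.

End cylinders.

(** * Local dimension and Frostman measures *)

Section local_dimension.
Context {R : realType} {d : nat}.
Local Notation V := 'rV[R]_d.
Variable mu : probability (borel_rV R d) R.
Local Notation P := (mass mu).

Definition regular_points (s r0 : R) : set V :=
  [set y | forall r, 0 < r < r0 -> P (closed_ball y r) <= r `^ s].

(** If the bound fails at [y] for the radius [r], continuity of the power gives [s1 > r] with
    [s1 ^ s < mu (B(y, r))]. For [z] within [s1 - r] of [y], the ball [B(z, s1)] contains [B(y, r)],
    so the bound fails at [z] too. Closedness gives measurability. *)
Lemma regular_points_closed s r0 : 0 <= s -> closed (regular_points s r0).
Proof.
move=> s0; rewrite -openC openE => y /existsNP[r /not_implyP[/andP[rp rr0]]].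
move=> /negP; rewrite -ltNge => yr.
have [s1 rs1 s1P] : exists2 s1, r < s1 < r0 & s1 `^ s < P (closed_ball y r).
  have : (fun t : R => t `^ s) @ r --> r `^ s.
    have [->|sN0] := eqVneq s 0.
      rewrite (_ : (fun t : R => t `^ 0) = cst 1); first by rewrite powRr0; exact: cvg_cst.
      by apply/funext => t; rewrite powRr0.
    apply: (@differentiable_continuous _ _ _ r (fun t : R => t `^ s)); apply/derivable1_diffP.
    by apply: derivable_powR; rewrite in_itv/= rp.
  move=> /cvgrPdist_lt/(_ (P (closed_ball y r) - r `^ s)).
  rewrite subr_gt0 => /(_ yr) [e /= e0 eP].
  pose t := Num.min (e / 2) ((r0 - r) / 2).
  have t0 : 0 < t by rewrite lt_min !divr_gt0// subr_gt0.
  have te : t < e by rewrite gt_min ltr_pdivrMr// mulr_natr mulr2n ltrDl e0.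
  have tr : t < r0 - r.
    by rewrite gt_min [X in _ || X]ltr_pdivrMr// mulr_natr mulr2n ltrDl subr_gt0 rr0 orbT.
  exists (r + t); first by rewrite ltrDl t0/= -ltrBrDl.
  have /eP : ball r e (r + t).
    by rewrite -ball_normE/= opprD addrA subrr sub0r normrN gtr0_norm.
  rewrite distrC => /(le_lt_trans (ler_norm _)).
  by rewrite ltrBlDr subrK.
have /andP[rs sr0] := rs1.
apply/nbhs_ballP; exists (s1 - r); first by rewrite /= subr_gt0.
move=> z /ballP yz /(_ s1); rewrite (lt_trans rp rs) sr0 => /(_ isT).
apply/negP; rewrite -ltNge (lt_le_trans s1P)// le_mass//; [exact: borel_closed_ball|
  exact: borel_closed_ball|].
apply: closed_ball_sub => //; first exact: lt_trans rs.
by rewrite -lerBrDr ltW.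
Qed.

Lemma local_exponent_gt s y r : 0 < r < 1 -> (s%:E < local_exponent mu y r)%E ->
  P (closed_ball y r) <= r `^ s.
Proof.
move=> /andP[r0 r1].
have lr : ln r < 0 by rewrite ln_lt0// r0.
rewrite /local_exponent massE; last exact: borel_closed_ball.
have [P0|P0] := leP (P (closed_ball y r)) 0.
  by move=> _; rewrite (le_trans P0)// powR_ge0.
rewrite lne_EFin// inver lt_eqF// -EFinM lte_fin => h.
rewrite -ler_ln ?posrE ?powR_gt0// ln_powR ltW//.
by rewrite -ltr_ndivlMr.
Qed.

(** Almost every point has lower local dimension above [s], hence is regular below some scale
    [1 / (n + 1)], and these sets increase with [n]. This plays the role of Egorov's theorem. *)
Lemma regular_points_mass s tau : 0 <= s -> (s%:E < lower_hausdorff_dim mu)%E ->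
  0 < tau -> exists2 r0, 0 < r0 <= 1 & 1 - tau < P (regular_points s r0).
Proof.
move=> s0 sD tau0.
have [N [mN N0 /subsetCl NS]] := ess_inf_le mu (fun x => limf_einf (local_exponent mu x) 0^'+).
pose F (n : nat) := regular_points s n.+1%:R^-1.
have mF n : borel (F n) by apply: borel_closed; exact: regular_points_closed.
have NF : ~` N `<=` \bigcup_n F n.
  move=> y /NS /= Dy.
  have : (s%:E < limf_einf (local_exponent mu y) 0^'+)%E by exact: lt_le_trans Dy.
  rewrite limf_einfE => /ereal_sup_gt[_ [U U0 <-] sU].
  have [e /= e0 eU] := U0.
  have [n ne] := exists_natinv_lt (Num.min e 1) ltac:(by rewrite lt_min e0 ltr01).
  exists n => // r /andP[r0 rn].
  apply: local_exponent_gt.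
    by rewrite r0 (lt_trans rn)// (lt_le_trans ne)// ge_min lexx orbT.
  rewrite (lt_le_trans sU)//; apply: ereal_inf_lbound; exists r => //.
  apply: eU => //; rewrite /ball_/= sub0r normrN gtr0_norm// (lt_trans rn)//.
  by rewrite (lt_le_trans ne)// ge_min lexx.
case: (@mass_bigcup_ge _ _ mu F (1 - tau) mF) => [n||n].
- move=> y Fy r /andP[r0 rn]; apply: Fy; rewrite r0 (lt_le_trans rn)//.
  by rewrite lef_pV2 ?posrE// ler_nat.
- rewrite (@lt_le_trans _ _ 1)// ?gtrBl//.
  rewrite (_ : 1 = P (~` N)); last by rewrite massC// /mass N0 subr0.
  by apply: le_mass => //; [exact: borel_setC|exact: borel_bigcup].
- move=> Fn; exists n.+1%:R^-1 => //.
  by rewrite invr_gt0 ltr0n/= invf_le1// ler1n.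
Qed.

Lemma lower_hausdorff_dim_ge0 : (0 <= lower_hausdorff_dim mu)%E.
Proof.
apply/ess_infP; apply: nearW => y; rewrite limf_einfE.
apply: le_trans (ereal_sup_ubound _); last first.
  exists [set r : R | 0 < r < 1] => //.
  exists 1 => //= r; rewrite /ball_/= sub0r normrN => r1 r0.
  by rewrite r0 (le_lt_trans (ler_norm _)).
apply: le_ereal_inf_tmp => _ [r /andP[r0 r1] <-].
rewrite /local_exponent massE; last exact: borel_closed_ball.
rewrite inver lt_eqF; last by rewrite ln_lt0// r0.
apply: mule_le0; last by rewrite lee_fin invr_le0 ln_le0// ltW.
by rewrite lne_le0 lee_fin mass_le1//; exact: borel_closed_ball.
Qed.

End local_dimension.

(** With infinite dimension some point of [K] would be regular for the exponent [h + 1], against the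
    lower bound [c * r ^ h] as soon as [r < c]. *)
Lemma lower_hausdorff_dim_lty {R : realType} {d m : nat}
  (f : 'I_m -> 'rV[R]_d -> 'rV[R]_d) (p : 'I_m -> R) (K : set 'rV[R]_d)
  (mu : probability (borel_rV R d) R) : (2 <= m)%N ->
  (forall i, contracting_similarity (f i)) -> is_attractor f K ->
  probability_vector p -> is_self_similar_measure f p mu ->
  (lower_hausdorff_dim mu < +oo)%E.
Proof.
move=> hm hf hK hp hmu.
have [c [h [c0 h0 Pc]]] := mass_closed_ball_ge _ _ _ _ hm hf hK hp hmu.
have h10 : 0 <= h + 1 by rewrite addr_ge0.
rewrite ltNge; apply/negP => Dy.
have [||r0 /andP[r00 r01] Pr0] := regular_points_mass mu (h + 1) 1 h10.
- by rewrite (lt_le_trans _ Dy)// ltry.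
- by [].
rewrite subrr in Pr0.
have mS : borel (regular_points mu (h + 1) r0).
  by apply: borel_closed; exact: regular_points_closed.
have [y [Ky yS]] : (K `&` regular_points mu (h + 1) r0) !=set0.
  apply/set0P/negP => /eqP K0; move: Pr0.
  rewrite -(mass1I mu K)//; last exact: (mass_attractor _ _ _ _ hm hf hK hp hmu).
    by rewrite K0 mass_set0 ltxx.
  exact: (borel_attractor _ _ hK).
pose r := Num.min (c / 2) (r0 / 2).
have rp : 0 < r by rewrite lt_min !divr_gt0.
have rc : r < c by rewrite gt_min ltr_pdivrMr// mulr_natr mulr2n ltrDl c0.
have rr0 : r < r0.
  by rewrite gt_min [X in _ || X]ltr_pdivrMr// mulr_natr mulr2n ltrDl r00 orbT.
have := yS r; rewrite rp rr0 => /(_ isT).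
apply/negP; rewrite -ltNge (lt_le_trans _ (Pc y r Ky _))//; last first.
  by rewrite rp (le_trans (ltW rr0)).
rewrite powRD; last by rewrite (gt_eqF rp) implybT.
by rewrite powRr1 ?(ltW rp)// mulrC ltr_pM2r// powR_gt0.
Qed.

(* The push-forward of [mu] restricted to [G] by [g] is a Frostman measure carried by
   [ball x r], with constants that depend neither on [x] nor on [r]. *)
Definition frostman_sets {R : realType} {d : nat} (mu : probability (borel_rV R d) R)
    (K : set 'rV[R]_d) (s A : R) (G : set 'rV[R]_d) :=
  forall x r, K x -> 0 < r <= 1 -> exists (g : 'rV[R]_d -> 'rV[R]_d) (q : R),
    [/\ 0 < q, continuous g, G `<=` g @^-1` (ball x r),
      (forall B, borel B -> q * mass mu (g @^-1` B) <= mass mu B) &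
      (forall z rho, 0 < rho ->
         mass mu (G `&` g @^-1` (closed_ball z rho)) <= A * (rho / r) `^ s)].

Section frostman.
Context {R : realType} {d m : nat}.
Local Notation V := 'rV[R]_d.
Variables (f : 'I_m -> V -> V) (p : 'I_m -> R) (K : set V).
Variable (mu : probability (borel_rV R d) R).
Hypotheses (hm : (2 <= m)%N) (hf : forall i, contracting_similarity (f i)).
Hypotheses (hK : is_attractor f K) (hp : probability_vector p).
Hypothesis hmu : is_self_similar_measure f p mu.
Local Notation P := (mass mu).

(** Points that [g] sends into a common ball of radius [rho] are within [C * rho / r] of each other,
    so those in [G] lie in one ball about a regular point. When the radius of that ball exceeds
    [r0], the factor [1 / r0] makes the bound at least 1. *)
Lemma frostman s : 0 <= s -> (s%:E < lower_hausdorff_dim mu)%E ->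
  exists (A : R) (G : set V), [/\ 0 < A, borel G, 2^-1 <= P G &
    frostman_sets mu K s A G].
Proof.
move=> s0 sD.
have [r0 /andP[r00 r01] Pr0] := regular_points_mass mu s 2^-1 s0 sD ltac:(by rewrite invr_gt0).
have [c [h [c0 h0 cyl]]] := exists_cylinder _ _ _ _ hm hf hK hp hmu.
have mK := borel_attractor _ _ hK.
have mS : borel (regular_points mu s r0).
  by apply: borel_closed; exact: regular_points_closed.
(* The 2 passes from radius to diameter, the root of [d] from the sup norm to the Euclidean norm,
   and [c] comes from [c * r <= k]; adding 1 keeps [C] positive. *)
pose C := 2 * Num.sqrt d%:R / c + 1.
have C0 : 0 < C by rewrite ltr_wpDl// divr_ge0// ?(ltW c0)// mulr_ge0// sqrtr_ge0.
exists ((C / r0) `^ s), (K `&` regular_points mu s r0); split.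
- by rewrite powR_gt0// divr_gt0.
- exact: borel_setI.
- rewrite mass1I//; last exact: (mass_attractor _ _ _ _ hm hf hK hp hmu).
  by rewrite (le_trans _ (ltW Pr0))// [leRHS](_ : _ = 2^-1)//; lra.
move=> x r Kx r1.
have [g [k [q [[k0 kq gsim gmu] ck gK]]]] := cyl x r Kx r1.
have /andP[rp _] := r1.
have cg : continuous g by exact: (similarity_continuous _ _ k0 gsim).
exists g, q; split => //.
- by rewrite (lt_le_trans _ kq)// powR_gt0.
- by move=> y [Ky _]; apply: gK; exists y.
move=> z rho rho0.
have mball : borel (g @^-1` closed_ball z rho).
  by apply: borel_preimage => //; exact: borel_closed_ball.
have mGB : borel ((K `&` regular_points mu s r0) `&` g @^-1` closed_ball z rho).
  by apply: borel_setI => //; exact: borel_setI.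
have [->|/set0P[y [[Ky Sy] gy]]] :=
    eqVneq ((K `&` regular_points mu s r0) `&` g @^-1` closed_ball z rho) set0.
  by rewrite mass_set0 mulr_ge0// powR_ge0.
pose t := C * (rho / r).
have t0 : 0 < t by rewrite mulr_gt0// divr_gt0.
rewrite -powRM ?divr_ge0 ?(ltW C0) ?(ltW r00) ?(ltW rho0) ?(ltW rp)//.
rewrite [X in X `^ s](_ : _ = t / r0); last by rewrite /t; field; rewrite !gt_eqF.
have tr0 : t <= t / r0 by rewrite ler_peMr ?(ltW t0)// invf_ge1.
have [tr|rt] := ltP t r0; last first.
  rewrite (le_trans (mass_le1 _ _ mGB))// (_ : 1 = 1 `^ s); last by rewrite powR1.
  by rewrite ge0_ler_powR// ?nnegrE// ?divr_ge0 ?(ltW t0) ?(ltW r00)// ler_pdivlMr// mul1r.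
rewrite (@le_trans _ _ (P (closed_ball y t)))//; last first.
  rewrite (le_trans (Sy _ _)) ?t0//.
  by rewrite ge0_ler_powR// nnegrE ?(ltW t0)// (le_trans (ltW t0)).
apply: le_mass => //; first exact: borel_closed_ball.
move=> y' [_ gy']; apply/closed_ballP => //.
rewrite (le_trans (norm_le_euclidean _))//.
have -> : euclidean_norm (y - y') = k^-1 * euclidean_norm (g y - g y').
  by rewrite gsim mulKf// gt_eqF.
rewrite ler_pdivrMl// (le_trans (euclidean_le_norm _))//.
have gyy : `|g y - g y'| <= 2 * rho.
  move: gy gy' => /closed_ballP-/(_ rho0) gy /closed_ballP-/(_ rho0) gy'.
  rewrite -(subrKA z) (le_trans (ler_normD _ _))// mulr_natl mulr2n lerD//.
  by rewrite distrC.
rewrite (le_trans (ler_wpM2l (sqrtr_ge0 _) gyy))//.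
rewrite (@le_trans _ _ ((c * r) * t))//; last by rewrite ler_wpM2r// ltW.
rewrite /t /C [leRHS](_ : _ = (2 * Num.sqrt d%:R + c) * rho).
  by rewrite mulrA ler_wpM2r ?(ltW rho0)// mulrC lerDl ltW.
by field; rewrite !gt_eqF.
Qed.

Lemma essential_content_ge s : (0 < d)%N -> 0 <= s -> (s%:E < lower_hausdorff_dim mu)%E ->
  exists2 c : R, 0 < c & forall x r, K x -> 0 < r <= 1 ->
    ((c * r `^ s)%:E <= essential_content mu s (ball x r))%E.
Proof.
move=> d0 s0 sD; have [A [G [A0 mG PG frost]]] := frostman s s0 sD.
exists ((2 * A)^-1); first by rewrite invr_gt0 mulr_gt0.
move=> x r Kx r1; have [g [q [q0 cg Gg gmu gA]]] := frost x r Kx r1.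
have /andP[rp _] := r1.
apply: le_ereal_inf_tmp => _ [E [mE EU EUE] <-].
apply: le_ereal_inf_tmp => _ [D [y [rho [rho0 _ Ecov ->]]]].
have mgE : borel (g @^-1` E) by exact: borel_preimage.
(* Full measure is inherited by the copy of [mu]: [q * mu (g^-1 (U \ E)) <= mu (U \ E) = 0], with
   [U] the ball. Hence a cover of [E] must carry the whole mass of [G], at least 1/2. *)
have PGE : P (G `&` g @^-1` E) = P G.
  have mb := borel_ball x r.
  have mgb : borel (g @^-1` ball x r) by exact: borel_preimage.
  have : q * P (g @^-1` (ball x r `\` E)) <= 0.
    rewrite (le_trans (gmu _ _))//; first exact: borel_setD.
    by rewrite massD// setIC (setIidl EU) /mass EUE subrr.
  rewrite pmulr_rle0// => gE0.
  apply/eqP; rewrite eq_le le_mass//=; last exact: borel_setI.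
  rewrite -subr_le0 -massD// (le_trans _ gE0)// le_mass//.
  - exact: borel_setD.
  - by apply: borel_preimage => //; exact: borel_setD.
  - by move=> z [Gz gz]; split => //; exact: Gg.
pose F n := if n \in D then G `&` g @^-1` closed_ball (y n) (rho n) else set0.
have mF n : borel (F n).
  rewrite /F; case: ifPn => _; last exact: measurable0.
  by apply: borel_setI => //; apply: borel_preimage => //; exact: borel_closed_ball.
pose a n := ((diam (closed_ball (y n) (rho n))) `^ s)%:E.
have : (mu (G `&` g @^-1` E) <= \sum_(n <oo) mu (F n))%E.
  apply: measure_sigma_subadditive => //; first exact: borel_setI.
  move=> z [Gz /Ecov[n Dn zn]]; exists n => //.
  by rewrite /F mem_set.
have : (\sum_(n <oo) mu (F n) <= \sum_(n <oo) (A * r `^ (- s))%:E * (if n \in D then a n else 0%E))%E.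
  apply: lee_nneseries => [n _ _|n _]; first exact: measure_ge0.
  rewrite /F; case: ifPn => [/set_mem Dn|_]; last by rewrite measure0 mule0.
  rewrite massE; last first.
    by apply: borel_setI => //; apply: borel_preimage => //; exact: borel_closed_ball.
  rewrite /a -EFinM lee_fin (le_trans (gA _ _ (rho0 _ Dn)))//.
  rewrite -mulrA ler_wpM2l ?(ltW A0)// powRM ?invr_ge0 ?(ltW rp)//; last exact/ltW/rho0.
  rewrite mulrC -[r^-1]powR_inv1 ?(ltW rp)// -powRrM mulN1r ler_wpM2l ?powR_ge0//.
  rewrite diam_closed_ball//; last exact: rho0.
  have := rho0 _ Dn => rn; rewrite ge0_ler_powR ?nnegrE ?(ltW rn)//.
    by rewrite mulr_ge0// ltW.
  by rewrite mulr_natl mulr2n lerDl ltW.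
rewrite nneseriesZl; last by move=> n _; case: ifP => // _; rewrite lee_fin powR_ge0.
have a0 n : (0 <= (if n \in D then a n else 0))%E.
  by case: ifP => // _; rewrite lee_fin powR_ge0.
rewrite nneseries_esumT// -(esum_mkcond D a).
rewrite massE ?PGE; last exact: borel_setI.
move=> h1 h2; have {h2}h1 := le_trans h2 h1.
rewrite -(@lee_pmul2l _ (A * r `^ (- s))%:E)//; last first.
  by rewrite lte_fin mulr_gt0// powR_gt0.
rewrite (le_trans _ h1)// -EFinM lee_fin (le_trans _ PG)//.
rewrite powRN [leLHS](_ : _ = 2^-1)//.
by field; rewrite (gt_eqF A0) gt_eqF// powR_gt0.
Qed.

End frostman.

(** * Asymptotically covering families *)

Section finite_unions.
Context {R : realType} {d : nat}.
Local Notation V := 'rV[R]_d.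
Variable mu : probability (borel_rV R d) R.
Local Notation P := (mass mu).

Definition pairwise_disjoint (J : seq nat) (F : nat -> set V) :=
  forall i j, i \in J -> j \in J -> i != j -> F i `&` F j = set0.

Definition seq_union (J : seq nat) (F : nat -> set V) : set V :=
  \bigcup_(n in [set` J]) F n.

Lemma seq_union_cons n J F : seq_union (n :: J) F = F n `|` seq_union J F.
Proof.
apply/seteqP; split => [z [i /=]|z [Fz|[i /= iJ Fz]]].
- by rewrite inE => /orP[/eqP->|iJ] Fz; [left|right; exists i].
- by exists n => //=; rewrite inE eqxx.
- by exists i => //=; rewrite inE iJ orbT.
Qed.

Lemma seq_union_nil F : seq_union [::] F = set0.
Proof. by apply/seteqP; split => // z [i]. Qed.

Lemma borel_seq_union J F : (forall n, borel (F n)) -> borel (seq_union J F).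
Proof. by move=> mF; exact: borel_bigcup. Qed.

Lemma closed_seq_union J F : (forall n, closed (F n)) -> closed (seq_union J F).
Proof.
move=> cF; elim: J => [|n J IH]; first by rewrite seq_union_nil; exact: closed0.
by rewrite seq_union_cons; apply: closedU.
Qed.

Lemma mass_seq_union_le (J : seq nat) F : (forall n, borel (F n)) ->
  P (seq_union J F) <= \sum_(n <- J) P (F n).
Proof.
move=> mF; elim: J => [|n J IH]; first by rewrite seq_union_nil mass_set0 big_nil.
rewrite seq_union_cons big_cons (le_trans (mass_subU _ _ _ _ _)) ?lerD2l//.
exact: borel_seq_union.
Qed.

Lemma mass_seq_union (J : seq nat) F : (forall n, borel (F n)) -> uniq J ->
  pairwise_disjoint J F -> P (seq_union J F) = \sum_(n <- J) P (F n).
Proof.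
move=> mF; elim: J => [|n J IH]; first by rewrite seq_union_nil mass_set0 big_nil.
move=> /= /andP[nJ uJ] dJ.
rewrite seq_union_cons big_cons massU ?IH//.
- by move=> i j iJ jJ; apply: dJ; rewrite inE ?iJ ?jJ orbT.
- exact: borel_seq_union.
- apply/seteqP; split => // z [Fz [i /= iJ Fi]].
  suff : set0 z by []; rewrite -(dJ n i)// ?inE ?eqxx ?iJ ?orbT//.
  by apply: contraNneq nJ => ->.
Qed.

Lemma asymptotically_coveringP (B : nat -> set V) (N : set nat) :
  (forall n, borel (B n)) ->
  asymptotically_covering mu B N <->
  exists2 C : R, 0 < C & forall (Omega : set V) (g : nat), open Omega ->
    exists J : seq nat, [/\ uniq J,
      forall n, n \in J -> [/\ N n, (g <= n)%N & B n `<=` Omega],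
      pairwise_disjoint J B & C * P Omega <= P (seq_union J B)].
Proof.
move=> mB; split => -[C C0 acB]; exists C => // Omega g oO.
  have [I [/finite_seqP[s ->] IP tI CI]] := acB _ g oO.
  have us : [set` s] = [set` undup s] by apply/seteqP; split=> n /=; rewrite mem_undup.
  exists (undup s); split; first exact: undup_uniq.
  - by move=> n; rewrite mem_undup => ns; exact: IP.
  - move=> i j; rewrite !mem_undup => si sj ij; apply/eqP; apply/negPn/negP => /set0P ne.
    by move/eqP : ij; apply; exact: tI.
  - move: CI; rewrite (massE mu Omega); last exact: borel_open.
    rewrite massE; last exact: borel_bigcup.
    by rewrite -EFinM lee_fin us.
have [J [uJ JP dJ CJ]] := acB _ g oO.
exists [set` J]; split => //.
- move=> i j /= iJ jJ [z Bz]; apply/eqP; apply: contraT => ij.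
  by have := dJ i j iJ jJ ij; rewrite -subset0 => /(_ z Bz).
- rewrite (massE mu Omega); last exact: borel_open.
  rewrite massE; last exact: borel_bigcup.
  by rewrite -EFinM lee_fin.
Qed.

(** The covering property is applied again to what the sets chosen so far leave uncovered, which is
    open because these sets are closed. Each round multiplies the uncovered mass by at most
    [1 - C]. *)
Lemma covering_exhaust (B : nat -> set V) (N : set nat) (Omega : set V) (g : nat) (tau : R) :
  (forall n, closed (B n)) -> asymptotically_covering mu B N -> open Omega -> 0 < tau ->
  exists J : seq nat, [/\ uniq J,
      forall n, n \in J -> [/\ N n, (g <= n)%N & B n `<=` Omega],
      pairwise_disjoint J B & P (Omega `\` seq_union J B) < tau].
Proof.
move=> cB; have mB n : borel (B n) by exact: borel_closed.
move=> /(asymptotically_coveringP _ _ mB)[C C0 acB] oO tau0.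
have C1 : C <= 1.
  have [J [_ _ _]] := acB setT 0%N openT; rewrite mass_setT mulr1 => /le_trans; apply.
  by rewrite mass_le1//; exact: borel_seq_union.
have C01 : 0 <= 1 - C < 1 by rewrite subr_ge0 C1 ltrBlDr ltrDl.
have [n ntau] := exists_expr_lt (1 - C) tau C01 tau0.
have mO : borel Omega by exact: borel_open.
suff [J [uJ JP dJ Jn]] : exists J : seq nat, [/\ uniq J,
      forall n, n \in J -> [/\ N n, (g <= n)%N & B n `<=` Omega],
      pairwise_disjoint J B & P (Omega `\` seq_union J B) <= (1 - C) ^+ n].
  by exists J; split => //; exact: le_lt_trans ntau.
elim: n {ntau} => [|n [J [uJ JP dJ Jn]]].
  exists [::]; split => //; rewrite expr0 mass_le1//.
  by apply: borel_setD => //; exact: borel_seq_union.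
have cJ : closed (seq_union J B) by exact: closed_seq_union.
have oD : open (Omega `\` seq_union J B) by apply: openI => //; exact: closed_openC.
have [J' [uJ' JP' dJ' CJ']] := acB _ g oD.
have JJ' i j : i \in J -> j \in J' -> B i `&` B j = set0.
  move=> iJ /JP'[_ _ jO]; apply/seteqP; split => // z [Bi /jO[_]].
  by apply; exists i.
(* Disjointness of the two rounds does not exclude a common index when [B i] is empty, so
   repetitions are removed by hand. *)
exists (J' ++ [seq i <- J | i \notin J']); split.
- rewrite cat_uniq uJ' filter_uniq// andbT; apply/hasPn => i.
  by rewrite mem_filter => /andP[].
- move=> i; rewrite mem_cat mem_filter => /orP[/JP'[Ni gi iO]|/andP[_ /JP//]].
  by split => // z /iO[].
- move=> i j; rewrite !mem_cat !mem_filter.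
  move=> /orP[iJ|/andP[_ iJ]] /orP[jJ|/andP[_ jJ]] ij.
  + exact: dJ'.
  + by rewrite setIC; exact: JJ'.
  + exact: JJ'.
  + exact: dJ.
have sub : Omega `\` seq_union (J' ++ [seq i <- J | i \notin J']) B `<=`
    (Omega `\` seq_union J B) `\` seq_union J' B.
  move=> z [Oz nz]; split; first split => //.
  - move=> [i /= iJ Bi]; apply: nz.
    exists i => //=; rewrite mem_cat mem_filter iJ andbT.
    by case: (i \in J').
  - by move=> [i /= iJ Bi]; apply: nz; exists i => //=; rewrite mem_cat iJ.
have mD : borel (Omega `\` seq_union J B) by exact: borel_open.
have mJ' : borel (seq_union J' B) by exact: borel_seq_union.
rewrite (le_trans (le_mass _ _ _ _ _ sub))//.
- by apply: borel_setD => //; exact: borel_seq_union.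
- exact: borel_setD.
rewrite massD// setIC setIidl; last by move=> z [i /= /JP'[_ _ iO] /iO].
rewrite (@le_trans _ _ ((1 - C) * P (Omega `\` seq_union J B)))//.
  by rewrite mulrBl mul1r lerD2l lerN2.
by rewrite exprS ler_wpM2l//; case/andP: C01.
Qed.

(** Since the limsup set has full mass and the radii tend to 0, finitely many balls inside [Omega]
    with large index cover more than half of its mass. Their Vitali subfamily covers them after
    tripling the radii, which costs a factor [C]. *)
Lemma doubling_covering (x : nat -> V) (r : nat -> R) (C : R) (n0 : nat) :
  (forall n, 0 < r n) -> r @ \oo --> 0 ->
  (forall n, (n0 <= n)%N ->
     P (closed_ball (x n) (3 * r n)) <= C * P (closed_ball (x n) (r n))) ->
  mu (lim_sup_set (fun n => closed_ball (x n) (r n))) = 1%E ->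
  asymptotically_covering mu (fun n => closed_ball (x n) (r n)) setT.
Proof.
move=> r0 rlim dbl L1; pose B n := closed_ball (x n) (r n).
have mB n : borel (B n) by exact: borel_closed_ball.
apply/asymptotically_coveringP => //.
have C1 : 0 < `|C| + 1 by rewrite ltr_wpDl.
(* The 2 is for the half of [mu Omega] that is kept; [|C| + 1] is a positive bound of [C], whose
   sign is not prescribed. *)
exists (2 * (`|C| + 1))^-1; first by rewrite invr_gt0 mulr_gt0.
move=> Omega g oO; have mO := borel_open _ oO.
have [PO|PO] := leP (P Omega) 0.
  exists [::]; split => //; rewrite seq_union_nil mass_set0.
  by rewrite pmulr_rle0// invr_gt0 mulr_gt0.
pose Q n := [&& (n0 <= n)%N, (g <= n)%N & `[< B n `<=` Omega >]].
pose s N := [seq n <- iota 0 N | Q n].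
have mL : borel (lim_sup_set B).
  rewrite /lim_sup_set -[X in borel X]setCK setC_bigcap.
  by apply: borel_setC; apply: borel_bigcup => n _; apply: borel_setC; exact: borel_bigcup.
have PL : P (lim_sup_set B) = 1 by rewrite /mass L1.
case: (@mass_bigcup_ge _ _ mu (fun N => seq_union (s N) B) (P Omega / 2)) => [N|N||N PN].
- exact: borel_seq_union.
- move=> z [i /=]; rewrite !mem_filter !mem_iota !add0n => /andP[Qi /andP[_ iN]] Bi.
  have iN1 : i \in s N.+1.
    by rewrite mem_filter mem_iota Qi add0n leq0n/= ltnS ltnW.
  by exists i.
- rewrite (@lt_le_trans _ _ (P Omega))//.
    by rewrite ltr_pdivrMr// mulr_natr mulr2n ltrDl.
  rewrite -(mass1I mu _ _ mL mO PL); apply: le_mass.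
  + exact: borel_setI.
  + by apply: borel_bigcup => n _; exact: borel_seq_union.
  move=> z [Lz Oz].
  have : nbhs z Omega by apply: open_nbhs_nbhs; split.
  rewrite -nbhs_ballE => -[e /= e0 eO].
  have /cvgrPdist_lt/(_ (e / 2) ltac:(by rewrite divr_gt0))[n1 _ n1P] := rlim.
  have [n /= n1n zn] := Lz (maxn n1 (maxn n0 g)) I.
  move: n1n; rewrite !geq_max => /and3P[n1n n0n gn].
  suff Qn : Q n.
    have nn : n \in s n.+1 by rewrite mem_filter mem_iota Qn add0n ltnSn.
    by exists n.+1 => //; exists n.
  rewrite /Q n0n gn/=.
  apply/asboolP => y By; apply: eO; apply/ballP.
  have rn : r n < e / 2.
    by have := n1P n n1n; rewrite /= sub0r normrN gtr0_norm.
  move: zn By => /closed_ballP-/(_ (r0 n)) zn /closed_ballP-/(_ (r0 n)) By.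
  rewrite -(subrKA (x n)) (le_lt_trans (ler_normD _ _))// distrC.
  rewrite (splitr e) ltrD//; exact: le_lt_trans rn.
have [t [ut ts dt tcov]] := vitali_finite x r (s N) r0.
have tQ n : n \in t -> Q n by move=> /ts; rewrite mem_filter => /andP[].
exists t; split => //.
  by move=> n /tQ/and3P[_ gn /asboolP].
rewrite mass_seq_union//.
have : P (seq_union (s N) B) <= \sum_(n <- t) P (closed_ball (x n) (3 * r n)).
  rewrite (le_trans _ (mass_seq_union_le _ _ _))//; last by move=> n; exact: borel_closed_ball.
  apply: le_mass; [exact: borel_seq_union|by apply: borel_bigcup => n _; exact: borel_closed_ball|].
  move=> z [i /= si /closed_ballP-/(_ (r0 i)) zi].
  have [j jt [ij rij]] := tcov i si.
  exists j => //; apply/closed_ballP; first by rewrite mulr_gt0.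
  rewrite -(subrKA (x i)) (le_trans (ler_normD _ _))//.
  rewrite distrC (le_trans (lerD ij zi))//.
  by rewrite addrAC [leRHS](_ : _ = r j + r j + r j) ?lerD//; ring.
move=> h1; rewrite ler_pdivrMl ?mulr_gt0// -mulrA -ler_pdivrMl//.
rewrite mulrC (le_trans (ltW PN))// (le_trans h1)// mulr_sumr.
rewrite big_seq [leRHS]big_seq; apply: ler_sum => n nt.
rewrite (le_trans (dbl n _))//; first by have /and3P[] := tQ n nt.
by rewrite ler_wpM2r ?mass_ge0// (le_trans (ler_norm _))// lerDl.
Qed.

End finite_unions.

(** * Trees of balls and gauge functions *)

Section hausdorff_lemmas.
Context {R : realType} {d : nat}.
Local Notation V := 'rV[R]_d.
Implicit Types (E : set V) (zeta : R -> R).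

Lemma hausdorff_measureE zeta E : hausdorff_measure zeta E =
  ereal_sup ((fun t => hausdorff_pre zeta t%:E E) @` `]0, 1[).
Proof.
apply: cvg_lim => //.
apply: (nonincreasing_at_right_cvge (BLeft 1)); first by rewrite bnd_simp.
move=> s t _ _ st; apply: ereal_inf_le_tmp => _ [D [y [rho [rho0 rhot Ecov ->]]]].
exists D, y, rho; split => // n Dn; rewrite (le_trans (rhot n Dn))//.
Qed.

Lemma hausdorff_measure_ge zeta E (c : \bar R) (t0 : R) : 0 < t0 < 1 ->
  (forall (D : set nat) y rho, (forall n, D n -> 0 < rho n) ->
     (forall n, D n -> diam (closed_ball (y n : V) (rho n)) <= t0) ->
     E `<=` \bigcup_(n in D) closed_ball (y n) (rho n) ->
     (c <= \esum_(n in D) (zeta (diam (closed_ball (y n) (rho n))))%:E)%E) ->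
  (c <= hausdorff_measure zeta E)%E.
Proof.
move=> t01 H; rewrite hausdorff_measureE.
apply: le_trans (ereal_sup_ubound _); last first.
  by exists t0 => //=; rewrite in_itv.
apply: le_ereal_inf_tmp => _ [D [y [rho [rho0 rhot Ecov ->]]]].
by apply: H => // n Dn; have := rhot n Dn; rewrite lee_fin.
Qed.

(** For [s < l] the gauge lies below [t ^ s] near 0, so if the measure of exponent [s] vanished, the
    gauge measure would too. *)
Lemma hausdorff_dim_ge zeta (l : R) E : (0 < d)%N ->
  (forall t, 0 <= t -> 0 <= zeta t) ->
  ln (zeta t) / ln t @[t --> 0^'+] --> l -> (0 < hausdorff_measure zeta E)%E ->
  (l%:E <= hausdorff_dim E)%E.
Proof.
move=> d0 zeta0 zl HE; apply: le_ereal_inf_tmp => _ [s [s0 Hs] <-].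
rewrite lee_fin leNgt; apply/negP => sl.
have : \forall t \near 0^'+, s < ln (zeta t) / ln t.
  exact: (cvgr_gt l).
move=> [e /= e0 eP].
pose t1 := Num.min (e / 2) 2^-1.
have t10 : 0 < t1 by rewrite lt_min divr_gt0// invr_gt0 ltr0n.
have t1e : t1 < e by rewrite gt_min ltr_pdivrMr// mulr_natr mulr2n ltrDl e0.
have t11 : t1 < 1 by rewrite gt_min invf_lt1// ltr1n orbT.
have le t : 0 < t <= t1 -> zeta t <= t `^ s.
  move=> /andP[tp tt1]; have [z0|z0] := leP (zeta t) 0.
    by rewrite (le_trans z0)// powR_ge0.
  have := eP t; rewrite /ball_/= sub0r normrN gtr0_norm// => /(_ (le_lt_trans tt1 t1e) tp).
  rewrite ltr_ndivlMr; last by rewrite ln_lt0// tp (le_lt_trans tt1).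
  by rewrite -ln_powR ltr_ln ?posrE ?powR_gt0// => /ltW.
have : (hausdorff_measure zeta E <= hausdorff_measure (fun t => t `^ s)%R E)%E.
  rewrite [leLHS]hausdorff_measureE.
  apply: ge_ereal_sup => _ [t + <-]; rewrite /= in_itv/= => /andP[tp t1'].
  pose t2 := Num.min t t1.
  have t20 : 0 < t2 by rewrite lt_min tp.
  apply: (@hausdorff_measure_ge _ _ _ t2).
    by rewrite t20 gt_min t1'.
  move=> D y rho rho0 rhot Ecov.
  apply: (@le_trans _ _ (\esum_(n in D) (zeta (diam (closed_ball (y n) (rho n))))%:E)).
    apply: ereal_inf_lbound; exists D, y, rho; split => // n Dn.
    by rewrite lee_fin (le_trans (rhot n Dn))// ge_min lexx.
  apply: le_esum => n Dn; rewrite lee_fin; apply: le; apply/andP; split.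
    by rewrite diam_closed_ball// ?mulr_gt0// rho0.
  by rewrite (le_trans (rhot n Dn))// ge_min lexx orbT.
by rewrite Hs leNgt HE.
Qed.

End hausdorff_lemmas.

(** The children depend on the generation as well as on the node, because the exponents and
    constants that govern their choice do. *)
Fixpoint tree_level (ch : nat -> nat -> seq nat) (root k : nat) : seq nat :=
  if k is k'.+1 then flatten [seq ch k' p | p <- tree_level ch root k'] else [:: root].

Lemma tree_levelS ch root k n p : p \in tree_level ch root k -> n \in ch k p ->
  n \in tree_level ch root k.+1.
Proof. by move=> pk np /=; apply/flattenP; exists (ch k p) => //; exact: map_f. Qed.

Lemma tree_levelSP ch root k n : n \in tree_level ch root k.+1 ->
  exists2 p, p \in tree_level ch root k & n \in ch k p.
Proof. by move=> /= /flattenP[s /mapP[p pk ->] ns]; exists p. Qed.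

(* The average of [h] over the descendants [j] generations below the node [p] of
   generation [k], weighted by the transition weights [w]. *)
Fixpoint tree_mean {R : realType} (ch : nat -> nat -> seq nat) (w : nat -> nat -> nat -> R)
    (h : nat -> R) (j k p : nat) : R :=
  if j is j'.+1 then \sum_(n <- ch k p) w k p n * tree_mean ch w h j' k.+1 n else h p.

Section tree_mean_theory.
Context {R : realType}.
Variables (ch : nat -> nat -> seq nat) (w : nat -> nat -> nat -> R) (root : nat).
Local Notation lev := (tree_level ch root).
Hypothesis w0 : forall k p n, p \in lev k -> n \in ch k p -> 0 <= w k p n.
Hypothesis w1 : forall k p, p \in lev k -> \sum_(n <- ch k p) w k p n = 1.

Lemma le_tree_mean (h h' : nat -> R) j k p : p \in lev k ->
  (forall n, n \in lev (k + j) -> h n <= h' n) ->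
  tree_mean ch w h j k p <= tree_mean ch w h' j k p.
Proof.
elim: j k p => [|j IH] k p pk hh'; first by apply: hh'; rewrite addn0.
rewrite /= big_seq [leRHS]big_seq; apply: ler_sum => n np.
apply: ler_wpM2l; first exact: w0.
by apply: IH; [exact: tree_levelS np|rewrite addSnnS].
Qed.

Lemma tree_mean_cst (c : R) j k p : p \in lev k -> tree_mean ch w (fun=> c) j k p = c.
Proof.
elim: j k p => //= j IH k p pk.
rewrite -[RHS]mul1r -(w1 k p pk) mulr_suml big_seq [RHS]big_seq.
by apply: eq_bigr => n np; rewrite IH//; exact: tree_levelS np.
Qed.

Lemma tree_mean_sum (I : Type) (s : seq I) (Q : pred I) (h : I -> nat -> R) j k p :
  tree_mean ch w (fun n => \sum_(i <- s | Q i) h i n) j k p =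
  \sum_(i <- s | Q i) tree_mean ch w (h i) j k p.
Proof.
elim: j k p => //= j IH k p.
under eq_bigr do rewrite IH mulr_sumr.
by rewrite exchange_big.
Qed.

End tree_mean_theory.

Section ball_tree.
Context {R : realType} {d : nat}.
Local Notation V := 'rV[R]_d.
Variables (c : nat -> V) (s : nat -> R) (ch : nat -> nat -> seq nat) (root : nat).
Hypothesis s0 : forall n, 0 < s n.
Local Notation lev := (tree_level ch root).
Local Notation B n := (closed_ball (c n) (s n)).
Hypothesis ch_sub : forall k p n, p \in lev k -> n \in ch k p -> B n `<=` B p.

Lemma closed_ball_compact (x : V) (e : R) : 0 < e -> compact (closed_ball x e).
Proof.
move=> e0; apply: bounded_closed_compact; last exact: closed_ball_closed.
exists (`|x| + e); split; first by rewrite num_real.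
move=> M xM y /closed_ballP-/(_ e0) xy /=.
rewrite -(subrK x y) (le_trans (ler_normD _ _))// addrC distrC.
by rewrite (le_trans _ (ltW xM))// lerD2l.
Qed.

(** Otherwise each generation [j] has a ball with a point [z j] outside the first [j] open sets. A
    cluster point of [z] lies in the closed union of every generation, by nesting, and outside every
    [O i]. *)
Lemma tree_covered (O : nat -> set V) : (forall i, open (O i)) ->
  (forall z, (forall k, exists2 n, n \in lev k & B n z) -> exists i, O i z) ->
  exists j, forall n, n \in lev j -> B n `<=` \bigcup_(i in [set i | (i < j)%N]) O i.
Proof.
move=> oO lev_cov; apply: contrapT => /forallNP H.
have /choice[z zP] j : exists z, (exists2 n, n \in lev j & B n z) /\
    forall i, (i < j)%N -> ~ O i z.
  have /existsNP[n /not_implyP[nj /existsNP[z /not_implyP[Bz nO]]]] := H j.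
  exists z; split; first by exists n.
  by move=> i ij Oz; apply: nO; exists i.
have down k j y : (exists2 n, n \in lev (k + j) & B n y) -> exists2 n, n \in lev k & B n y.
  elim: j => [|j IH]; first by rewrite addn0.
  rewrite addnS => -[n /tree_levelSP[p pk np] Bn]; apply: IH.
  by exists p => //; exact: (ch_sub (k + j) p n).
have [y [By yc]] : B root `&` cluster (z @ \oo) !=set0.
  apply: closed_ball_compact => //; exists 0%N => // j _ /=.
  have [+ _] := zP j; rewrite -[j]add0n => /down[n].
  by rewrite inE => /eqP->.
have yclosed (C : set V) : closed C -> (\forall j \near \oo, C (z j)) -> C y.
  move=> cC Cz; rewrite (closure_id C).1// => A nA.
  by have [u [Cu Au]] := yc C A Cz nA; exists u.
have [k|i Oy] := lev_cov y.
  have cL : closed (seq_union (lev k) (fun n => B n)).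
    by apply: closed_seq_union => n; exact: closed_ball_closed.
  have [n nk Bn] : seq_union (lev k) (fun n => B n) y.
    apply: yclosed => //; exists k => // j /= kj.
    have [+ _] := zP j; rewrite -(subnKC kj) => /down[n nk Bn].
    by exists n.
  by exists n.
suff : (~` O i) y by [].
apply: yclosed; first exact: open_closedC.
by exists i.+1 => // j /= ij; have [_] := zP j; apply.
Qed.

End ball_tree.

(** * Gauges with a stepwise increasing exponent *)

Section step_gauge.
Context {R : realType}.
Variables (a e : nat -> R) (l : R).
Hypothesis a0 : forall k, 0 < a k.
Hypothesis a_lt : forall k, a k <= k.+1%:R^-1.
Hypothesis e0 : forall k, 0 < e k.
Hypothesis e_nd : forall k k', (k <= k')%N -> e k <= e k'.
Hypothesis e_cvg : e @ \oo --> l.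

(** The generation that governs the scale [t]. The default 0 is taken for [t <= 0], where no [k]
    qualifies. *)
Definition gauge_index (t : R) : nat :=
  if pselect (exists k, a k.+1 < t) is left h then ex_minn h else 0%N.

Definition step_gauge (t : R) : R := t `^ e (gauge_index t).

Lemma gauge_index_ex t : 0 < t -> exists k, a k.+1 < t.
Proof.
move=> t0; have [n nt] := exists_natinv_lt t t0.
exists n; rewrite (le_lt_trans (a_lt _))// (lt_trans _ nt)//.
by rewrite ltf_pV2 ?posrE// ltr_nat.
Qed.

Lemma gauge_index_le t k : a k.+1 < t -> (gauge_index t <= k)%N.
Proof.
move=> kt; rewrite /gauge_index; case: pselect => // h.
by case: ex_minnP => n _; exact.
Qed.

Lemma gauge_index_lt t : 0 < t -> a (gauge_index t).+1 < t.
Proof.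
move=> t0; rewrite /gauge_index; case: pselect => [h|[]]; last exact: gauge_index_ex.
by case: ex_minnP.
Qed.

Lemma step_gauge_ge0 t : 0 <= step_gauge t.
Proof. exact: powR_ge0. Qed.

Lemma powR_le_step_gauge t k : a k.+1 < t -> t <= 1 -> t `^ e k <= step_gauge t.
Proof.
move=> kt t1; apply: ger_powR; first by rewrite t1 (lt_trans _ kt).
by apply: e_nd; exact: gauge_index_le.
Qed.

(** As [t] decreases its index can only grow, and with it the exponent; below 1 a larger exponent
    lowers the power, so the jumps go in the same direction as the powers. *)
Lemma gauge_step_gauge : gauge step_gauge.
Proof.
split; first by move=> t _; exact: step_gauge_ge0.
  by rewrite /step_gauge powR0// gt_eqF.
exists 1 => // t u; rewrite !in_itv/= => /andP[t0 t1] /andP[u0 u1] tu.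
have up : 0 < u by rewrite (le_lt_trans t0).
rewrite (@le_lt_trans _ _ (t `^ e (gauge_index u)))//; last first.
  by apply: gt0_ltr_powR; rewrite ?nnegrE.
have [->|tN0] := eqVneq t 0.
  by rewrite /step_gauge !powR0// ?gt_eqF.
have tp : 0 < t by rewrite lt_neqAle eq_sym tN0.
apply: ger_powR; first by rewrite tp t1.
apply: e_nd; apply: gauge_index_le.
by rewrite (lt_trans _ tu)// gauge_index_lt.
Qed.

Lemma step_gauge_cvg : ln (step_gauge t) / ln t @[t --> 0^'+] --> l.
Proof.
apply/cvgrPdist_lt => eps eps0.
have /cvgrPdist_lt/(_ _ eps0)[n _ nP] := e_cvg.
(* Below [a 1], ..., [a n] the index is at least [n], and the quotient of logarithms is exactly the
   exponent at the index. *)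
pose t0 := \big[Num.min/2^-1]_(k < n) a k.+1.
have t00 : 0 < t0.
  by apply/bigmin_gtP; split => [|i _]; rewrite ?invr_gt0.
near=> t.
have tp : 0 < t by near: t; exact: nbhs_right_gt.
have tt : t < t0 by near: t; exact: nbhs_right_lt.
have t1 : t < 1.
  by rewrite (lt_trans tt)// (le_lt_trans (bigmin_le_id _ _ _ _))// invf_lt1// ltr1n.
have lt0 : ln t < 0 by rewrite ln_lt0// tp.
rewrite /step_gauge ln_powR mulfK ?lt_eqF//.
apply: nP; rewrite /= leqNgt; apply/negP => kn.
have := gauge_index_lt t tp; apply/negP; rewrite -leNgt (le_trans (ltW tt))//.
exact: (bigmin_le_cond _ _ (j := Ordinal kn)).
Unshelve. all: by end_near. Qed.

End step_gauge.

(** * Mass distribution on a tree of balls *)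

Section tree_gauge.
Context {R : realType} {d : nat}.
Local Notation V := 'rV[R]_d.
Variables (x : nat -> V) (r : nat -> R) (delta : R).
Hypotheses (d0 : (0 < d)%N) (r0 : forall n, 0 < r n) (delta1 : 1 <= delta).
Local Notation rho n := (r n `^ delta).
(* The factor 1/3 keeps the sets of a generation well separated even if [delta = 1]. *)
Local Notation B n := (closed_ball (x n) (r n `^ delta / 3)).

Definition touches (z : V) (lam : R) (n : nat) : bool :=
  `[< (B n `&` closed_ball z lam) !=set0 >].

Variables (A e : nat -> R) (l : R).
Hypothesis A1 : forall k, 1 <= A k.
Hypothesis e0 : forall k, 0 < e k.
Hypothesis e_nd : forall k k', (k <= k')%N -> e k <= e k'.
Hypothesis e_cvg : e @ \oo --> l.

(** One step of the mass distribution, from the node [p] of generation [k] to [J] with proportions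
    [w]. The bound 1/4 makes node masses decay geometrically. The inequality with [A k.+1]
    propagates the invariant [A k * m <= rho p ^ e k] for the mass [m] of a node. The last clause is
    a Frostman bound for balls that meet two children; these balls must not be too small compared
    with the children. *)
Definition admissible_children (k p : nat) (J : seq nat) (w : nat -> R) :=
  [/\ uniq J, \sum_(n <- J) w n = 1,
     (forall n, n \in J -> [/\ (k <= n)%N, r n <= 1, B n `<=` B p, 0 <= w n <= 4^-1 &
        A k.+1 * rho p `^ e k * w n <= A k * rho n `^ e k.+1]) &
     (forall z lam n n', 0 < lam -> n \in J -> n' \in J -> n != n' ->
        touches z lam n -> touches z lam n' ->
        r n < 3 * lam /\
        \sum_(i <- J | touches z lam i) w i <= A k * (lam / rho p) `^ e k)].

Hypothesis children : forall k p, r p <= 1 -> exists J w, admissible_children k p J w.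
Hypothesis root_ex : exists n, r n <= 1.

Let rho0 n : 0 < rho n. Proof. exact: powR_gt0. Qed.
Let B0 n : 0 < rho n / 3. Proof. by rewrite divr_gt0. Qed.

(** A ball of radius [lam] is followed down the tree while it meets a single child. When it first
    meets two children of a node [p] of generation [k] and mass [m], it has
    [lam > r n / 3 >= a k.+1], so its gauge is at least [lam ^ e k], whereas its mass is at most [m
    * A k * (lam / rho p) ^ e k <= lam ^ e k] by the invariant. If this never happens, its mass at
    generation [j] is at most [m0 / 4 ^ j]. *)
Theorem tree_gauge : exists zeta : R -> R,
  [/\ gauge zeta, ln (zeta t) / ln t @[t --> 0^'+] --> l &
    (0 < hausdorff_measure zeta (lim_sup_set (fun n => (ball_pow (x n) (r n) delta)°)))%E].
Proof.
have [root rt1] := root_ex.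
have [ch [w chP]] : exists ch w, forall k p, r p <= 1 ->
    admissible_children k p (ch k p) (w k p).
  have /choice[F FP] (kp : nat * nat) : exists Jw : seq nat * (nat -> R),
      r kp.2 <= 1 -> admissible_children kp.1 kp.2 Jw.1 Jw.2.
    have [r1|r1] := leP (r kp.2) 1; last by exists ([::], fun=> 0).
    by have [J [w Jw]] := children kp.1 kp.2 r1; exists (J, w).
  exists (fun k p => (F (k, p)).1), (fun k p => (F (k, p)).2) => k p.
  exact: (FP (k, p)).
pose lev := tree_level ch root.
have lev1 k p : p \in lev k -> r p <= 1.
  elim: k p => [|k IH] p; first by rewrite inE => /eqP->.
  move=> /tree_levelSP[q /IH q1 pq].
  by have [_ _ /(_ p pq)[]] := chP k q q1.
have chP' k p : p \in lev k -> admissible_children k p (ch k p) (w k p).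
  by move=> /lev1; exact: chP.
have w0 k p n : p \in lev k -> n \in ch k p -> 0 <= w k p n.
  by move=> pk np; have [_ _ /(_ n np)[_ _ _ /andP[]]] := chP' k p pk.
have w1 k p : p \in lev k -> \sum_(n <- ch k p) w k p n = 1.
  by move=> pk; have [] := chP' k p pk.
have ch_sub k p n : p \in lev k -> n \in ch k p -> B n `<=` B p.
  by move=> pk np; have [_ _ /(_ n np)[]] := chP' k p pk.
pose a k := Num.min k.+1%:R^-1 (\big[Num.min/1]_(n <- lev k) (r n / 3)).
have a0 k : 0 < a k.
  rewrite lt_min invr_gt0 ltr0n/=.
  by elim/big_ind : _ => // [u v u0 v0|n _]; rewrite ?lt_min ?u0 ?divr_gt0.
have a_lt k : a k <= k.+1%:R^-1 by rewrite ge_min lexx.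
have a_lev k n : n \in lev k -> a k <= r n / 3.
  by move=> nk; rewrite ge_min; apply/orP; right; exact: ge_bigmin_seq.
exists (step_gauge a e); split.
- exact: gauge_step_gauge.
- exact: step_gauge_cvg.
(* The largest total mass for which the invariant holds at the root. *)
pose m0 := rho root `^ e 0%N / A 0%N.
have Ap k : 0 < A k by rewrite (lt_le_trans ltr01).
have m00 : 0 < m0 by rewrite divr_gt0// powR_gt0.
pose h (z : V) lam n : R := (touches z lam n)%:R.
have h_le1 z lam n : h z lam n <= 1 by rewrite /h; case: touches.
have mean_le1 z lam j k p : p \in lev k -> tree_mean ch w (h z lam) j k p <= 1.
  move=> pk; rewrite -[leRHS](tree_mean_cst _ _ root w1 1 j k p pk).
  exact: (le_tree_mean _ _ root w0).
have mean_ge0 z lam j k p : p \in lev k -> 0 <= tree_mean ch w (h z lam) j k p.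
  move=> pk; rewrite -[leLHS](tree_mean_cst _ _ root w1 0 j k p pk).
  apply: (le_tree_mean _ _ root w0) => // n _; exact: ler0n.
have touch_mean z lam j k p : p \in lev k -> ~~ touches z lam p ->
    tree_mean ch w (h z lam) j k p = 0.
  elim: j k p => [|j IH] k p pk tp /=; first by rewrite /h (negbTE tp).
  rewrite big_seq big1// => n np; rewrite IH ?mulr0//; first exact: tree_levelS np.
  apply: contra tp => /asboolP[y [By zy]]; apply/asboolP; exists y; split => //.
  exact: ch_sub np _ By.
have key z lam : 0 < lam <= 1 -> forall j k p m, p \in lev k -> 0 <= m ->
    m <= m0 * 4^-1 ^+ k -> A k * m <= rho p `^ e k ->
    m * tree_mean ch w (h z lam) j k p <=
      Num.max (step_gauge a e lam) (m0 * 4^-1 ^+ (k + j)).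
  move=> /andP[lam0 lam1]; elim => [|j IH] k p m pk mp mm0 Am.
    by rewrite addn0 le_max (le_trans _ mm0) ?orbT//= -[leRHS]mulr1 ler_wpM2l.
  have [uJ _ JP dJ] := chP' k p pk.
  have [[n [n' [nJ n'J nn' tn tn']]]|Huniq] := pselect (exists n n', [/\ n \in ch k p,
      n' \in ch k p, n != n', touches z lam n & touches z lam n']).
    rewrite le_max; apply/orP; left => /=.
    have [rn wt] := dJ z lam n n' lam0 nJ n'J nn' tn tn'.
    have lev_n : n \in lev k.+1 by exact: tree_levelS nJ.
    rewrite (le_trans _ (powR_le_step_gauge _ _ a0 e_nd lam k _ _))//; last first.
      by rewrite (le_lt_trans (a_lev _ _ lev_n))// ltr_pdivrMr// mulrC.
    rewrite (@le_trans _ _ (m * \sum_(i <- ch k p | touches z lam i) w k p i))//.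
      rewrite ler_wpM2l// [leRHS]big_mkcond/= big_seq [leRHS]big_seq; apply: ler_sum => i iJ.
      have ik : i \in lev k.+1 by exact: tree_levelS iJ.
      case: ifPn => ti; last by rewrite touch_mean// mulr0.
      by rewrite -[leRHS]mulr1 ler_wpM2l ?mean_le1// w0.
    rewrite (le_trans (ler_wpM2l mp wt))// mulrA [m * _]mulrC.
    rewrite (le_trans (ler_wpM2r (powR_ge0 _ _) Am))//.
    rewrite -powRM ?divr_ge0 ?(ltW lam0) ?(ltW (rho0 p))//.
    by rewrite mulrC divfK// gt_eqF.
  have [[n [nJ tn]]|none] := pselect (exists n, n \in ch k p /\ touches z lam n); last first.
    rewrite /= big_seq big1 ?mulr0 ?le_max ?step_gauge_ge0// => n nJ.
    rewrite touch_mean ?mulr0//; first exact: tree_levelS nJ.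
    by apply/negP => tn; apply: none; exists n.
  have lev_n : n \in lev k.+1 by exact: tree_levelS nJ.
  rewrite /= (bigD1_seq n)//= [X in _ + X]big_seq_cond big1 ?addr0; last first.
    move=> i /andP[iJ ni]; rewrite touch_mean ?mulr0//; first exact: tree_levelS iJ.
    by apply/negP => ti; apply: Huniq; exists i, n.
  have [_ rn1 _ /andP[wn0 wn4] Aw] := JP n nJ.
  rewrite mulrA addnS -addSn.
  apply: (IH k.+1 n (m * w k p n) lev_n).
  - exact: mulr_ge0.
  - by rewrite exprSr mulrA ler_pM.
  - rewrite -(ler_pM2l (Ap k)) (le_trans _ Aw)//.
    rewrite mulrCA -mulrA ler_wpM2l ?(ltW (Ap _))// mulrA ler_wpM2r//.
have m0_half : (0%:E < (m0 / 2)%:E)%E by rewrite lte_fin divr_gt0.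
apply: (lt_le_trans m0_half).
apply: (@hausdorff_measure_ge _ _ _ _ _ 2^-1).
  by rewrite invr_gt0 ltr0n invf_lt1// ltr1n.
move=> D y rad rad0 radt Ecov.
(* The diameter is twice the radius, so the open ball of radius [lam n] contains the closed ball of
   the cover, and the gauge is already evaluated at [lam n]. *)
pose lam n := diam (closed_ball (y n) (rad n)).
pose O i := if i \in D then ball (y i) (lam i) else set0.
have lam0 i : D i -> 0 < lam i.
  by move=> Di; rewrite /lam diam_closed_ball ?mulr_gt0 ?rad0.
have [j jcov] : exists j, forall n, n \in lev j ->
    B n `<=` \bigcup_(i in [set i | (i < j)%N]) O i.
  apply: tree_covered => // [i|z zlev].
    by rewrite /O; case: ifP => _; [exact: ball_open|exact: open0].
  have : lim_sup_set (fun n => (ball_pow (x n) (r n) delta)°) z.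
    (* A node of generation [N + 1] was chosen as a child at generation [N], hence has index at
       least [N]. *)
    move=> N _; have [n nN Bn] := zlev N.+1.
    have [q qN nq] := tree_levelSP _ _ _ _ nN.
    exists n => /=; first by have [_ _ /(_ n nq)[]] := chP' N q qN.
    rewrite /ball_pow interior_closed_ballE//; apply/ballP.
    move: Bn => /closed_ballP-/(_ (B0 n)) /le_lt_trans; apply.
    by rewrite ltr_pdivrMr// ltr_pMr ?ltr1n.
  move=> /Ecov[i Di /closed_ballP-/(_ (rad0 i Di)) yz].
  exists i; rewrite /O mem_set//; apply/ballP; rewrite (le_lt_trans yz)//.
  by rewrite /lam diam_closed_ball ?rad0// mulr_natl mulr2n ltrDl rad0.
have root0 : root \in lev 0%N by rewrite inE.
have main : m0 <= \sum_(i < j | (i : nat) \in D) (step_gauge a e (lam i) + m0 * 4^-1 ^+ j).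
  have mean1 := tree_mean_cst _ _ root w1 1 j 0 root root0.
  rewrite -[leLHS]mulr1 -[X in m0 * X <= _]mean1.
  rewrite (@le_trans _ _ (m0 * tree_mean ch w
      (fun n => \sum_(i < j | (i : nat) \in D) h (y i) (lam i) n) j 0 root))//.
    rewrite ler_wpM2l ?(ltW m00)//; apply: (le_tree_mean _ _ root w0) => // n nj.
    have Bn : B n (x n) by apply/closed_ballP; rewrite ?subrr ?normr0 ?(ltW (B0 n)).
    have [i /= ij] := jcov n nj _ Bn; rewrite /O; case: ifPn => // iD yi.
    rewrite (bigD1 (Ordinal ij))//= /h.
    have -> : touches (y i) (lam i) n.
      by apply/asboolP; exists (x n); split => //; exact: subset_closed_ball.
    by rewrite lerDl; apply: sumr_ge0 => ? _; exact: ler0n.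
  rewrite tree_mean_sum mulr_sumr; apply: ler_sum => i /set_mem iD.
  rewrite (le_trans (key (y i) (lam i) _ j 0%N root m0 _ _ _ _))//.
  - by rewrite lam0//= (le_trans (radt i iD))// invf_le1// ler1n.
  - exact: ltW.
  - by rewrite expr0 mulr1.
  - by rewrite /m0 mulrC divfK// gt_eqF.
  - rewrite add0n ge_max lerDl lerDr step_gauge_ge0 andbT.
    by rewrite mulr_ge0 ?(ltW m00)// exprn_ge0// invr_ge0.
(* The errors of the at most [j] balls in use add up to at most [j / 4 ^ j <= 1/2] of [m0]. *)
have half : \sum_(i < j | (i : nat) \in D) m0 * 4^-1 ^+ j <= m0 / 2.
  rewrite (@le_trans _ _ (\sum_(i < j) m0 * 4^-1 ^+ j))//.
    rewrite big_mkcond/=; apply: ler_sum => i _; case: ifP => // _.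
    by rewrite mulr_ge0 ?(ltW m00)// exprn_ge0// invr_ge0.
  rewrite sumr_const card_ord -mulrnAr ler_wpM2l ?(ltW m00)//.
  have jj n : n.+1%:R * 4^-1 ^+ n.+1 <= 2^-1 :> R.
    elim: n => [|n IH]; first by rewrite expr1 mul1r lef_pV2 ?posrE ?ler_nat.
    rewrite (le_trans _ IH)// exprS mulrA ler_wpM2r ?exprn_ge0 ?invr_ge0//.
    by rewrite ler_pdivrMr// -natrM ler_nat; lia.
  case: j {jcov main} => [|j]; first by rewrite mulr0n invr_ge0.
  by rewrite -mulr_natl.
rewrite big_split/= in main.
rewrite esum_mkcond -nneseries_esumT; last first.
  by move=> n; case: ifP => // _; rewrite lee_fin step_gauge_ge0.
apply: le_trans (nneseries_lim_ge j _) ; last first.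
  by move=> n _ _; case: ifP => // _; rewrite lee_fin step_gauge_ge0.
rewrite big_mkord (eq_bigr (fun i : 'I_j => (if (i : nat) \in D then step_gauge a e (lam i) else 0)%:E)).
  rewrite sumEFin lee_fin -big_mkcond/= -(lerD2r (m0 / 2)) -splitr.
  by rewrite (le_trans main)// lerD2l.
by move=> i _; case: ifP.
Qed.

End tree_gauge.

Lemma powR_small {R : realType} (eta c : R) : 0 < eta -> 0 < c ->
  exists2 t, 0 < t <= 1 & forall u, 0 < u <= t -> u `^ eta <= c.
Proof.
move=> eta0 c0; exists (Num.min 1 (c `^ eta^-1)).
  by rewrite lt_min ltr01 powR_gt0//= ge_min lexx.
move=> u /andP[u0]; rewrite le_min => /andP[_ uc].
rewrite (@le_trans _ _ ((c `^ eta^-1) `^ eta))//.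
  by rewrite ge0_ler_powR ?nnegrE ?powR_ge0// ltW.
by rewrite -powRrM mulVf ?gt_eqF// powRr1// ltW.
Qed.

(** * Choice of the children of a node *)

Section children.
Context {R : realType} {d : nat}.
Local Notation V := 'rV[R]_d.
Variables (K : set V) (mu : probability (borel_rV R d) R).
Local Notation P := (mass mu).
Variables (x : nat -> V) (r : nat -> R) (delta : R).
Hypotheses (d0 : (0 < d)%N) (r0 : forall n, 0 < r n) (delta1 : 1 <= delta).
Hypotheses (xK : forall n, K (x n)) (rlim : r @ \oo --> 0).
Local Notation B n := (closed_ball (x n) (r n)).
Local Notation rho n := (r n `^ delta).
Hypothesis frost : forall s, 0 <= s -> (s%:E < lower_hausdorff_dim mu)%E ->
  exists (A : R) (G : set V), [/\ 0 < A, borel G, 2^-1 <= P G & frostman_sets mu K s A G].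
Hypothesis ac : asymptotically_covering mu (fun n => B n) setT.

Let rho0 n : 0 < rho n. Proof. exact: powR_gt0. Qed.

(** The weights are the normalised masses of the chosen balls for the Frostman measure [nu] of the
    ball of radius [rho p / 3]. Children contained in a ball are disjoint, so their masses add up to
    at most the [nu] mass of that ball. *)
Lemma mass_children s : 0 <= s -> (s%:E < lower_hausdorff_dim mu)%E ->
  exists2 A : R, 0 < A & forall p g, r p <= 1 -> exists (J : seq nat) (w : nat -> R),
   [/\ uniq J, \sum_(n <- J) w n = 1,
    (forall n, n \in J -> [/\ (g <= n)%N, B n `<=` ball (x p) (rho p / 3) & 0 <= w n]),
    pairwise_disjoint J (fun n => B n) &
    forall z lam, 0 < lam ->
      \sum_(n <- J | `[< B n `<=` closed_ball z lam >]) w n <= A * (lam / rho p) `^ s].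
Proof.
move=> s0 sD; have [A [G [A0 mG PG fr]]] := frost s s0 sD.
(* The 4 bounds the inverse of the total mass [W], and [3 ^ s] comes from the radius [rho p / 3]. *)
exists (4 * A * 3 `^ s); first by rewrite !mulr_gt0// powR_gt0.
move=> p g rp1.
have rho1 : 0 < rho p / 3 <= 1.
  rewrite divr_gt0//= ler_pdivrMr// mul1r (@le_trans _ _ 1)//.
    by rewrite (le_trans (ge1r_powR _ delta1))// r0 rp1.
  by rewrite ler1n.
have [q_map [q [q0 cq Gq qmu qA]]] := fr (x p) (rho p / 3) (xK p) rho1.
pose nu S := P (G `&` q_map @^-1` S).
have mpre S : borel S -> borel (q_map @^-1` S) by exact: borel_preimage.
have mB n : borel (B n) by exact: borel_closed_ball.
have cB n : closed (B n) by exact: closed_ball_closed.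
have oU : open (ball (x p) (rho p / 3)) by exact: ball_open.
(* Missing at most [q / 4] of [mu] means missing at most 1/4 of [nu], so that [W >= 1/2 - 1/4]. *)
have [|J [uJ JP dJ Jtau]] := covering_exhaust mu (fun n => B n) setT
    (ball (x p) (rho p / 3)) g (q / 4) cB ac oU.
  by rewrite divr_gt0.
pose W := \sum_(n <- J) nu (B n).
have nuU (J' : seq nat) : uniq J' -> {subset J' <= J} ->
    nu (seq_union J' (fun n => B n)) = \sum_(n <- J') nu (B n).
  move=> uJ' J'J; rewrite /nu -(mass_seq_union mu J' (fun n => G `&` q_map @^-1` B n))//.
  - congr (mass mu _); apply/seteqP; split => [y [Gy [n nJ By]]|y [n nJ [Gy By]]].
      by exists n.
    by split => //; exists n.
  - by move=> n; apply: borel_setI => //; exact: mpre.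
  - move=> i j iJ jJ ij; apply/seteqP; split => // y [[_ Bi] [_ Bj]].
    suff : set0 (q_map y) by [].
    by rewrite -(dJ i j _ _ ij); [split|exact: J'J|exact: J'J].
have nu_ge0 S : 0 <= nu S by exact: mass_ge0.
have W4 : 4^-1 <= W.
  rewrite /W -nuU// /nu.
  have mU : borel (seq_union J (fun n => B n)) by exact: borel_seq_union.
  have mb := borel_ball (x p) (rho p / 3).
  have mD := borel_setD _ _ mb mU.
  have h1 : P G <= P (G `&` q_map @^-1` seq_union J (fun n => B n)) +
      P (q_map @^-1` (ball (x p) (rho p / 3) `\` seq_union J (fun n => B n))).
    rewrite (le_trans _ (mass_subU _ _ _ _ _))//.
    + apply: le_mass => //.
        by apply: borel_setU; [apply: borel_setI => //; exact: mpre|exact: mpre].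
      move=> y Gy; have [yU|yU] := pselect (seq_union J (fun n => B n) (q_map y)).
        by left.
      by right; split => //; exact: Gq.
    + by apply: borel_setI => //; exact: mpre.
    + exact: mpre.
  have h2 : P (q_map @^-1` (ball (x p) (rho p / 3) `\` seq_union J (fun n => B n))) <= 4^-1.
    by rewrite -(ler_pM2l q0) (le_trans (qmu _ mD))// ltW.
  lra.
have W0 : 0 < W by rewrite (lt_le_trans _ W4)// invr_gt0.
exists J, (fun n => nu (B n) / W); split => //.
- by rewrite -mulr_suml divff// gt_eqF.
- by move=> n nJ; have [_ gn Bn] := JP n nJ; split => //; rewrite divr_ge0// ltW.
move=> z lam lam0.
rewrite -mulr_suml -big_filter -nuU ?filter_uniq//; last first.
  by move=> n; rewrite mem_filter => /andP[].
rewrite ler_pdivrMr// (@le_trans _ _ (nu (closed_ball z lam)))//.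
  apply: le_mass.
  - apply: borel_setI => //; apply: mpre; exact: borel_seq_union.
  - by apply: borel_setI => //; apply: mpre; exact: borel_closed_ball.
  - move=> y [Gy [n /=]]; rewrite mem_filter => /andP[/asboolP Bz _] By.
    by split => //; exact: Bz.
rewrite (le_trans (qA _ _ lam0))//.
rewrite (_ : lam / (rho p / 3) = 3 * (lam / rho p)); last first.
  by field; rewrite gt_eqF.
rewrite powRM ?divr_ge0 ?(ltW lam0) ?(ltW (rho0 p))//.
rewrite [leRHS](_ : _ = (A * (3 `^ s * (lam / rho p) `^ s)) * (4 * W)); last by ring.
by rewrite ler_peMr ?mulr_ge0 ?powR_ge0 ?(ltW A0)//; lra.
Qed.

Lemma dim_gauge (D : R) : 0 < D -> lower_hausdorff_dim mu = D%:E ->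
  exists zeta : R -> R,
  [/\ gauge zeta, ln (zeta t) / ln t @[t --> 0^'+] --> D / delta &
    (0 < hausdorff_measure zeta (lim_sup_set (fun n => (ball_pow (x n) (r n) delta)°)))%E].
Proof.
move=> D0 DE.
have delta0 : 0 < delta by rewrite (lt_le_trans ltr01).
(* Tying [s k] to [e k.+2] gives [delta * e k.+1 < s k < D]: the upper bound makes Frostman sets
   available, the lower one is the slack that absorbs the constants at small radii. *)
pose e k : R := D / delta * (1 - k.+2%:R^-1).
pose s k := delta * e k.+2.
have inv1 k : (k.+2%:R^-1 : R) < 1 by rewrite invf_lt1// ltr1n.
have e0 k : 0 < e k by rewrite mulr_gt0 ?divr_gt0// subr_gt0.
have e_nd k k' : (k <= k')%N -> e k <= e k'.
  move=> kk; rewrite ler_wpM2l ?divr_ge0 ?(ltW D0) ?(ltW delta0)// lerD2l lerN2.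
  by rewrite lef_pV2 ?posrE// ler_nat.
have e_lt k : e k < e k.+1.
  rewrite ltr_pM2l ?divr_gt0// ltrD2l ltrN2 ltf_pV2 ?posrE//.
  by rewrite ltr_nat.
have e_cvg : e @ \oo --> D / delta.
  rewrite -[X in _ --> X]mulr1; apply: cvgM; first exact: cvg_cst.
  rewrite -[X in _ --> X]subr0; apply: cvgB; first exact: cvg_cst.
  have := @cvg_harmonic R; rewrite -(cvg_shiftn 1).
  by under eq_fun do rewrite /= addn1.
have s0 k : 0 <= s k by rewrite mulr_ge0 ?(ltW delta0)// ltW.
have sD k : ((s k)%:E < lower_hausdorff_dim mu)%E.
  rewrite DE lte_fin /s /e mulrA [delta * _]mulrC divfK ?gt_eqF//.
  by rewrite gtr_pMr// gtrBl invr_gt0.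
have se k : e k <= s k.
  apply: (le_trans (e_nd k k.+2 _)); first by lia.
  by rewrite /s; apply: ler_peMl => //; rewrite ltW.
have /choice[A AP] k : exists A : R, 0 < A /\ forall p g, r p <= 1 ->
    exists (J : seq nat) (w : nat -> R),
   [/\ uniq J, \sum_(n <- J) w n = 1,
    (forall n, n \in J -> [/\ (g <= n)%N, B n `<=` ball (x p) (rho p / 3) & 0 <= w n]),
    pairwise_disjoint J (fun n => B n) &
    forall z lam, 0 < lam ->
      \sum_(n <- J | `[< B n `<=` closed_ball z lam >]) w n <= A * (lam / rho p) `^ s k].
  by have [A A0 AP] := mass_children (s k) (s0 k) (sD k); exists A.
pose A' k := Num.max 1 (A k * 5 `^ s k).
have A'1 k : 1 <= A' k by rewrite le_max lexx.
have A'0 k : 0 < A' k by rewrite (lt_le_trans ltr01).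
have A0 k : 0 < A k by have [] := AP k.
apply: (tree_gauge x r delta d0 r0 delta1 A' e (D / delta) A'1 e0 e_nd e_cvg); last first.
  have /cvgrPdist_lt/(_ _ ltr01)[n _ /(_ n (leqnn n))] := rlim.
  by rewrite /= sub0r normrN gtr0_norm// => /ltW rn; exists n.
move=> k p rp1.
have rhop1 : rho p <= 1.
  by rewrite (le_trans (ge1r_powR _ delta1))// r0 rp1.
(* As [w n <= A k * (r n / rho p) ^ s k], propagating the invariant reduces to
   [c1 * r n ^ (s k - delta * e k.+1) <= 1]. The threshold [t2] is chosen for this, and [t1] for the
   bound 1/4 on the weights. *)
pose c1 := A' k.+1 * rho p `^ e k * (A k * (rho p)^-1 `^ s k).
have c10 : 0 < c1 by rewrite !mulr_gt0 ?powR_gt0 ?invr_gt0.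
have [||t1 /andP[t10 t11] t1P] := powR_small (s k) (4^-1 / (A k * (rho p)^-1 `^ s k)).
- by rewrite mulr_gt0.
- by rewrite divr_gt0 ?invr_gt0 ?mulr_gt0 ?powR_gt0 ?invr_gt0.
have [||t2 /andP[t20 t21] t2P] := powR_small (s k - delta * e k.+1) c1^-1.
- by rewrite subr_gt0 ltr_pM2l.
- by rewrite invr_gt0.
have t120 : 0 < Num.min t1 t2 by rewrite lt_min t10.
have /cvgrPdist_lt/(_ _ t120)[g _ gP] := rlim.
have [_ /(_ p (maxn g k) rp1)[J [w [uJ sw JP dJ Jcl]]]] := AP k.
have Jr n : n \in J -> r n <= t1 /\ r n <= t2.
  move=> /JP[]; rewrite geq_max => /andP[/gP/= + _] _ _.
  by rewrite sub0r normrN gtr0_norm// lt_min => /andP[/ltW ? /ltW].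
have Jr1 n : n \in J -> r n <= 1 by move=> /Jr[rt1 _]; exact: le_trans t11.
have rho_le n : n \in J -> rho n <= r n.
  by move=> nJ; rewrite (ge1r_powR _ delta1)// r0 Jr1.
have wn n : n \in J -> w n <= A k * (rho p)^-1 `^ s k * r n `^ s k.
  move=> nJ; have := Jcl (x n) (r n) (r0 n).
  rewrite powRM ?invr_ge0 ?(ltW (r0 n)) ?(ltW (rho0 p))// mulrCA mulrC.
  apply: le_trans; rewrite big_mkcond (bigD1_seq n)//=.
  rewrite asboolT//= lerDl big_seq_cond; apply: sumr_ge0 => i /andP[iJ _].
  by case: ifP => // _; have [] := JP i iJ.
exists J, w; split => //.
- move=> n nJ; have [+ Bn w0] := JP n nJ; rewrite geq_max => /andP[gn kn].
  have [rt1 rt2] := Jr n nJ.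
  split => //.
  + exact: Jr1.
  + move=> y By; apply: subset_closed_ball; apply: Bn.
    move: By => /closed_ballP-/(_ (divr_gt0 (rho0 n) _)) By.
    apply/closed_ballP => //; rewrite (le_trans (By _))//.
    by rewrite ler_pdivrMr// (le_trans (rho_le n nJ))// ler_peMr ?ler1n// ltW.
  + rewrite w0 (le_trans (wn n nJ))//= mulrC -ler_pdivlMr; last first.
      by rewrite mulr_gt0// powR_gt0 ?invr_gt0.
    by apply: t1P; rewrite r0.
  + rewrite (@le_trans _ _ (c1 * r n `^ s k))//.
      by rewrite /c1 -[leRHS]mulrA ler_wpM2l ?wn// mulr_ge0 ?powR_ge0 ?(ltW (A'0 _)).
    rewrite (@le_trans _ _ (rho n `^ e k.+1))//; last by rewrite ler_peMl// powR_ge0.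
    rewrite -powRrM -[s k](subrKC (delta * e k.+1)) powRD; last by rewrite (gt_eqF (r0 n)) implybT.
    rewrite mulrCA -[leRHS]mulr1 ler_wpM2l ?powR_ge0// mulrC -ler_pdivlMr// mul1r.
    by apply: t2P; rewrite r0.
- move=> z lam n n' lam0 nJ n'J nn' tn tn'.
  (* The balls of radii [r i] and [r i'] are disjoint, but only concentric balls of at most a third
     of these radii are touched; this leaves [2/3 * (r i + r i') < 2 * lam]. *)
  have close i i' : i \in J -> i' \in J -> i != i' -> touches x r delta z lam i ->
      touches x r delta z lam i' -> r i < 3 * lam.
    move=> iJ i'J ii' /asboolP[u [ui /closed_ballP-/(_ lam0) uz]].
    move=> /asboolP[v [vi /closed_ballP-/(_ lam0) vz]].
    have h1 := disjoint_closed_balls _ _ _ _ (r0 i) (r0 i') (dJ i i' iJ i'J ii').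
    move: ui vi => /closed_ballP-/(_ (divr_gt0 (rho0 i) _)) ui.
    move=> /closed_ballP-/(_ (divr_gt0 (rho0 i') _)) vi.
    have {}ui : `|x i - u| <= r i / 3.
      by rewrite (le_trans (ui _))// ler_wpM2r ?invr_ge0// rho_le.
    have {}vi : `|x i' - v| <= r i' / 3.
      by rewrite (le_trans (vi _))// ler_wpM2r ?invr_ge0// rho_le.
    have h2 : `|x i - x i'| <= `|x i - u| + `|z - u| + `|z - v| + `|x i' - v|.
      rewrite [`|z - u|]distrC [`|x i' - v|]distrC.
      rewrite (le_trans (ler_distD v _ _))// lerD2r.
      rewrite (le_trans (ler_distD z _ _))// lerD2r.
      by rewrite (le_trans (ler_distD u _ _)).
    have := r0 i'; lra.
  have far i : i \in J -> touches x r delta z lam i -> r i < 3 * lam.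
    move=> iJ ti; have [in'|in'] := eqVneq i n.
      by apply: (close i n') => //; rewrite in'.
    exact: (close i n).
  split; first exact: far.
  have [lp|pl] := leP lam (rho p); last first.
    rewrite (@le_trans _ _ 1)//.
      rewrite -sw [leLHS]big_mkcond/= big_seq [leRHS]big_seq; apply: ler_sum => i iJ.
      by case: ifP => // _; have [] := JP i iJ.
    rewrite -[leLHS]mulr1 ler_pM// (_ : 1 = 1 `^ e k); last by rewrite powR1.
    rewrite ge0_ler_powR ?nnegrE ?divr_ge0 ?(ltW (e0 k)) ?(ltW lam0) ?(ltW (rho0 p))//.
    by rewrite ler_pdivlMr// mul1r ltW.
  (* A touched child has its centre within [r i / 3 + lam] of [z], and [r i < 3 * lam], so the whole
     ball fits in radius [5 * lam]. *)
  have lam50 : 0 < 5 * lam by rewrite mulr_gt0.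
  rewrite (@le_trans _ _ (A k * (5 * lam / rho p) `^ s k))//.
    rewrite (le_trans _ (Jcl z (5 * lam) lam50))//.
    rewrite big_mkcond [leRHS]big_mkcond/= big_seq [leRHS]big_seq.
    apply: ler_sum => i iJ; have [_ _ wi0] := JP i iJ.
    case: ifPn => [ti|_]; last by case: ifP.
    rewrite asboolT//; apply: closed_ball_sub => //.
    have ri := far i iJ ti.
    move: ti => /asboolP[u [ui /closed_ballP-/(_ lam0) uz]].
    move: ui => /closed_ballP-/(_ (divr_gt0 (rho0 i) _)) ui.
    have {}ui : `|x i - u| <= r i / 3.
      by rewrite (le_trans (ui _))// ler_wpM2r ?invr_ge0// rho_le.
    have := ler_distD u (x i) z; rewrite [`|u - z|]distrC => h2.
    lra.
  rewrite -mulrA powRM ?divr_ge0 ?(ltW lam0) ?(ltW (rho0 p))// mulrA.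
  rewrite ler_pM ?mulr_ge0 ?powR_ge0 ?(ltW (A0 k))//.
    by rewrite /A' le_max lexx orbT.
  by apply: ger_powR => //; rewrite divr_gt0//= ler_pdivrMr// mul1r.
Qed.

End children.

(** * Exponents and the ubiquity theorem *)

Lemma cvg_powR0 {R : realType} (u : nat -> R) (a : R) : 0 < a ->
  (forall n, 0 < u n) -> u @ \oo --> 0 -> (fun n => u n `^ a) @ \oo --> 0.
Proof.
move=> a0 u0 ul; apply/cvgrPdist_lt => eps eps0.
have [||t /andP[t0 _] tP] := powR_small a (eps / 2); rewrite ?divr_gt0//.
have /cvgrPdist_lt/(_ _ t0)[n _ nP] := ul.
exists n => // k /nP /=; rewrite !sub0r !normrN !gtr0_norm ?powR_gt0// => uk.
by rewrite (le_lt_trans (tP _ _)) ?u0 ?(ltW uk)// ltr_pdivrMr// mulr_natr mulr2n ltrDl.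
Qed.

Lemma cvg_div_ln {R : realType} (u : nat -> R) (c : R) :
  (forall n, 0 < u n) -> u @ \oo --> 0 -> (fun n => c / ln (u n)) @ \oo --> 0.
Proof.
move=> u0 ul; apply/cvgrPdist_lt => eps eps0.
pose t := expR (- ((`|c| + 1) / eps)).
have /cvgrPdist_lt/(_ _ (expR_gt0 _ : 0 < t))[n _ nP] := ul.
exists n => // k /nP /=; rewrite !sub0r !normrN gtr0_norm// => uk.
have c0 : 0 < (`|c| + 1) / eps by rewrite divr_gt0// ltr_wpDl.
have lnu : ln (u k) < - ((`|c| + 1) / eps).
  by rewrite -ltr_expR lnK ?posrE.
have ln0 : ln (u k) < 0 by rewrite (lt_trans lnu)// oppr_lt0.
rewrite normrM normfV (ltr0_norm ln0) ltr_pdivrMr ?oppr_gt0// mulrC.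
rewrite -ltr_pdivrMr// (le_lt_trans _ (_ : (`|c| + 1) / eps < _))//.
  by rewrite ler_wpM2r ?invr_ge0 ?(ltW eps0)// lerDl.
by rewrite ltrNr.
Qed.

Section content.
Context {R : realType} {d : nat}.
Local Notation V := 'rV[R]_d.
Variable mu : probability (borel_rV R d) R.

Lemma esum_ge1 (D : set nat) (a : nat -> \bar R) n : (forall i, D i -> (0 <= a i)%E) -> D n ->
  (a n <= \esum_(i in D) a i)%E.
Proof.
move=> a0 Dn; apply: esum_ge; exists [set n]; last by rewrite fsbig_set1.
by split => // i ->.
Qed.

Lemma essential_content_le s (y : V) (rho : R) : (0 < d)%N -> 0 < rho ->
  (essential_content mu s (ball y rho) <= ((2 * rho) `^ s)%:E)%E.
Proof.
move=> d0 rho0.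
apply: (@le_trans _ _ (hausdorff_content s (ball y rho))).
  apply: ereal_inf_lbound; exists (ball y rho) => //.
  by split => //; exact: borel_ball.
apply: ereal_inf_lbound; exists [set 0%N], (fun=> y), (fun=> rho); split => //.
- by move=> n _; rewrite leey.
- by move=> z yz; exists 0%N => //; exact: subset_closed_ball.
- by rewrite esum_set1 ?lee_fin ?powR_ge0// diam_closed_ball.
Qed.

Lemma hausdorff_content0_ge1 (E : set V) : (0 < d)%N -> E !=set0 ->
  (1 <= hausdorff_content 0 E)%E.
Proof.
move=> d0 [z Ez]; apply: le_ereal_inf_tmp => _ [D [y [rho [rho0 _ Ecov ->]]]].
have [n Dn _] := Ecov z Ez.
apply: (le_trans _ (esum_ge1 _ _ n _ Dn)); first by rewrite powRr0.
by move=> i _; rewrite lee_fin powR_ge0.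
Qed.

Lemma hausdorff_measure_le zeta (E E' : set V) : E `<=` E' ->
  (hausdorff_measure zeta E <= hausdorff_measure zeta E')%E.
Proof.
move=> EE'; rewrite !hausdorff_measureE.
apply: ge_ereal_sup => _ [t t01 <-].
apply: le_trans (ereal_sup_ubound _); last by exists t.
apply: ereal_inf_le_tmp => _ [D [y [rho [rho0 rhot Ecov ->]]]].
by exists D, y, rho; split => //; exact: subset_trans Ecov.
Qed.

Lemma hausdorff_dim_ge0 (E : set V) : (0 <= hausdorff_dim E)%E.
Proof. by apply: le_ereal_inf_tmp => _ [s [s0 _] <-]; rewrite lee_fin. Qed.

(* Gauges need not be continuous at 0, and this one charges points. *)
Definition point_gauge (t : R) : R := if 0 < t then 1 + t else 0.

Lemma gauge_point_gauge : gauge point_gauge.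
Proof.
rewrite /point_gauge; split; last 1 first.
- exists 1 => // t u; rewrite !in_itv/= => /andP[t0 _] /andP[u0 _] tu.
  have up : 0 < u by rewrite (le_lt_trans t0).
  rewrite up; case: ifPn => _; first by rewrite ltrD2l.
  by rewrite addr_gt0.
- by move=> t _; case: ifPn => // t0; rewrite addr_ge0// ltW.
- by rewrite ltxx.
Qed.

Lemma point_gauge_cvg : ln (point_gauge t) / ln t @[t --> 0^'+] --> (0 : R).
Proof.
apply/cvgrPdist_lt => eps eps0; near=> t.
have tp : 0 < t by near: t; exact: nbhs_right_gt.
have te : t < expR (-1) by near: t; apply: nbhs_right_lt; exact: expR_gt0.
have teps : t < eps by near: t; exact: nbhs_right_lt.
have lt1 : ln t < - 1 by rewrite -ltr_expR lnK// posrE.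
have lt0 : ln t < 0 by rewrite (lt_trans lt1).
rewrite /point_gauge tp sub0r normrN normrM normfV (ltr0_norm lt0).
rewrite ger0_norm ?ln_ge0 ?lerDl ?(ltW tp)//.
rewrite ltr_pdivrMr ?oppr_gt0// (@le_lt_trans _ _ t)//.
  by rewrite le_ln1Dx// (lt_trans _ tp)// oppr_lt0.
by rewrite (lt_le_trans teps)// ler_peMr ?(ltW eps0)// lerNr ltW.
Unshelve. all: by end_near. Qed.

Lemma point_gauge_measure (E : set V) : (0 < d)%N -> E !=set0 ->
  (0 < hausdorff_measure point_gauge E)%E.
Proof.
move=> d0 [z Ez]; apply: (@lt_le_trans _ _ 1%E); first by rewrite lte01.
apply: (@hausdorff_measure_ge _ _ _ _ _ 2^-1).
  by rewrite invr_gt0 ltr0n invf_lt1// ltr1n.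
move=> D y rho rho0 _ Ecov; have [n Dn _] := Ecov z Ez.
have pg i : D i -> (1%:E <= (point_gauge (diam (closed_ball (y i) (rho i))))%:E)%E.
  move=> Di; have ri := rho0 i Di; rewrite diam_closed_ball// /point_gauge mulr_gt0//.
  by rewrite lee_fin lerDl mulr_ge0// ltW.
apply: (le_trans (pg n Dn)); apply: (esum_ge1 D (fun i => (point_gauge (diam (closed_ball (y i) (rho i))))%:E)) => //.
by move=> i /pg; apply: le_trans.
Qed.

End content.

(** * Conclusions for asymptotically covering sequences *)

Section ubiquity.
Context {R : realType} {d : nat}.
Local Notation V := 'rV[R]_d.
Variables (K : set V) (mu : probability (borel_rV R d) R) (D : R).
Local Notation P := (mass mu).
Variables (x : nat -> V) (r : nat -> R) (delta : R).
Hypotheses (d0 : (0 < d)%N) (r0 : forall n, 0 < r n) (delta1 : 1 <= delta).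
Hypotheses (xK : forall n, K (x n)) (rlim : r @ \oo --> 0).
Local Notation B n := (closed_ball (x n) (r n)).
Local Notation rho n := (r n `^ delta).
Hypotheses (D0 : 0 <= D) (DE : lower_hausdorff_dim mu = D%:E).
Hypothesis P_ball_gt0 : forall y e, K y -> 0 < e -> 0 < P (ball y e).
Hypothesis content_ge : forall s, 0 <= s -> (s%:E < lower_hausdorff_dim mu)%E ->
  exists2 c : R, 0 < c & forall y e, K y -> 0 < e <= 1 ->
    ((c * e `^ s)%:E <= essential_content mu s (ball y e))%E.
Hypothesis frost : forall s, 0 <= s -> (s%:E < lower_hausdorff_dim mu)%E ->
  exists (A : R) (G : set V), [/\ 0 < A, borel G, 2^-1 <= P G & frostman_sets mu K s A G].

Let delta0 : 0 < delta. Proof. by rewrite (lt_le_trans ltr01). Qed.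
Let rho0 n : 0 < rho n. Proof. exact: powR_gt0. Qed.

Let eventually_lt (u : nat -> R) (e : R) : (forall n, 0 < u n) -> u @ \oo --> 0 -> 0 < e ->
  exists n, forall k, (n <= k)%N -> u k < e.
Proof.
move=> u0 ul e0; have /cvgrPdist_lt/(_ _ e0)[n _ nP] := ul.
by exists n => k /nP /=; rewrite sub0r normrN gtr0_norm.
Qed.

Let rho_lim : (fun n => rho n) @ \oo --> 0.
Proof. exact: cvg_powR0. Qed.

Let ball_powE n : (ball_pow (x n) (r n) delta)° = ball (x n) (rho n).
Proof. by rewrite /ball_pow interior_closed_ballE. Qed.

(** The ball covers itself, and [content_ge] is the matching lower bound, so the logarithm of the
    content differs from [s * ln (2 * rho n)] by a bounded amount, negligible against the logarithm
    of the diameter. The limsup is in fact a limit. *)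
Lemma t_epsE eps : 0 < eps < D -> t_eps mu delta x r eps = (D - eps)%:E.
Proof.
move=> /andP[eps0 epsD]; rewrite /t_eps DE /=; set s := D - eps.
have s0 : 0 <= s by rewrite subr_ge0 ltW.
have [|c c0 cP] := content_ge s s0.
  by rewrite DE lte_fin gtrBl.
have rho20 n : 0 < 2 * rho n by rewrite mulr_gt0.
have rho2l : (fun n => 2 * rho n) @ \oo --> 0.
  by rewrite -[X in _ --> X](mulr0 2); apply: cvgM => //; exact: cvg_cst.
pose c' := ln c - s * ln 2.
suff : (fun n => (lne (essential_content mu s (ball_pow (x n) (r n) delta)°)
    / (ln (diam (ball_pow (x n) (r n) delta)))%:E)%E) @ \oo --> s%:E.
  by move/cvg_limn_einf_sup => [].
apply: (@squeeze_cvge _ _ _ _ (fun=> s%:E) _ (fun n => (s + c' / ln (2 * rho n))%:E)).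
- have half0 : (0 : R) < 2^-1 by rewrite invr_gt0.
  have [N NP] := eventually_lt _ _ rho0 rho_lim half0.
  exists N => // n /NP rn.
  rewrite ball_powE /ball_pow diam_closed_ball//.
  have r21 : 2 * rho n < 1 by rewrite mulrC -ltr_pdivlMr// mul1r.
  have ln0 : ln (2 * rho n) < 0 by rewrite ln_lt0// rho20.
  have r1 : rho n <= 1 by rewrite (le_trans (ltW rn))// invf_le1// ler1n.
  have lo := cP (x n) (rho n) (xK n); rewrite rho0 r1 in lo.
  have {}lo := lo isT.
  have hi := essential_content_le mu s (x n) (rho n) d0 (rho0 n).
  have : (fine (essential_content mu s (ball (x n) (rho n))))%:E
      = essential_content mu s (ball (x n) (rho n)).
    rewrite fineK// fin_numE; apply/andP; split.
      by apply: contraTneq lo => ->; rewrite -ltNge ltNyr.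
    by apply: contraTneq hi => ->; rewrite -ltNge ltry.
  set v := fine _ => vE; rewrite -vE !lee_fin in lo hi.
  have crs0 : 0 < c * rho n `^ s by rewrite mulr_gt0// powR_gt0.
  have v0 : 0 < v by rewrite (lt_le_trans crs0).
  rewrite -vE lne_EFin// inver lt_eqF// -EFinM !lee_fin ler_ndivlMr// -ln_powR.
  rewrite ler_ln ?posrE ?powR_gt0// hi/=.
  rewrite ler_ndivrMr// mulrDl divfK ?lt_eqF// /c'.
  rewrite lnM ?posrE// [leLHS](_ : _ = ln c + s * ln (rho n)); last by ring.
  by rewrite -ln_powR -lnM ?posrE ?powR_gt0// ler_ln ?posrE.
- exact: cvg_cst.
- apply: cvg_EFin; first exact: nearW.
  rewrite -[X in _ --> X](addr0 s); apply: cvgD; first exact: cvg_cst.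
  exact: cvg_div_ln.
Qed.

Lemma t_exponent_cvg : 0 < D -> t_eps mu delta x r eps @[eps --> 0^'+] --> D%:E.
Proof.
move=> Dp; apply: (@cvg_trans _ ((D - eps)%:E @[eps --> 0^'+])).
  apply: near_eq_cvg; near=> eps; rewrite t_epsE//; apply/andP; split.
    by near: eps; exact: nbhs_right_gt.
  by near: eps; exact: nbhs_right_lt.
apply: cvg_EFin; first exact: nearW.
rewrite -[X in _ --> X](subr0 D); apply: cvgB; first exact: cvg_cst.
exact: cvg_at_right_filter.
Unshelve. all: by end_near. Qed.

(** Serves the case of dimension 0. A ball centred on [K] is charged, hence contains balls of the
    sequence of arbitrarily large index. The nested sequence so obtained is a tree with one child
    per node; if its intersection were empty, compactness would let empty sets cover one of its
    balls. *)
Lemma limsup_nonempty : asymptotically_covering mu (fun n => B n) setT ->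
  lim_sup_set (fun n => (ball_pow (x n) (r n) delta)°) !=set0.
Proof.
move=> ac; apply/set0P/negP => /eqP L0.
pose s n := rho n / 3.
have s0 n : 0 < s n by rewrite divr_gt0.
have next p g : exists n, (g <= n)%N /\ closed_ball (x n) (s n) `<=` closed_ball (x p) (s p).
  have [N NP] := eventually_lt _ _ r0 rlim ltr01.
  have oU : open (ball (x p) (s p)) by exact: ball_open.
  have Pp := P_ball_gt0 (x p) (s p) (xK p) (s0 p).
  have cB n : closed (B n) by exact: closed_ball_closed.
  have [[|n J] [uJ JP dJ]] := covering_exhaust mu (fun n => B n) setT
    (ball (x p) (s p)) (maxn g N) (P (ball (x p) (s p))) cB ac oU Pp.
    by rewrite seq_union_nil setD0 ltxx.
  move=> _; exists n; have [_ + Bn] := JP n (mem_head _ _).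
  rewrite geq_max => /andP[gn /NP rn]; split => // y yn.
  apply: subset_closed_ball; apply: Bn; apply: closed_ball_sub yn => //.
  rewrite subrr normr0 add0r /s ler_pdivrMr//.
  rewrite (le_trans (ge1r_powR _ delta1)) ?r0 ?(ltW rn)//.
  by rewrite ler_peMr ?ler1n// ltW.
have /choice[nx nxP] (pg : nat * nat) := next pg.1 pg.2.
pose ch k p := [:: nx (p, k)].
have chs k p n : p \in tree_level ch 0 k -> n \in ch k p ->
    closed_ball (x n) (s n) `<=` closed_ball (x p) (s p).
  by move=> _; rewrite inE => /eqP->; have [] := nxP (p, k).
have [|z zlev|j jcov] := tree_covered x s ch 0 s0 chs (fun=> set0).
- by move=> _; exact: open0.
- suff : set0 z by [].
  rewrite -L0 => N _; have [n nN Bn] := zlev N.+1.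
  have [q qN] := tree_levelSP _ _ _ _ nN; rewrite inE => /eqP nq.
  exists n; first by rewrite nq /=; have [] := nxP (q, N).
  rewrite ball_powE; apply/ballP.
  move: Bn => /closed_ballP-/(_ (s0 n)) /le_lt_trans; apply.
  by rewrite ltr_pdivrMr// ltr_pMr ?ltr1n.
have [n nj] : exists n, n \in tree_level ch 0 j.
  elim: j {jcov} => [|j [p pj]]; first by exists 0%N; rewrite inE.
  by exists (nx (p, j)); apply: tree_levelS pj _; rewrite inE.
by have [i _ []] := jcov n nj (x n) (closed_ball_center _ _ (s0 n)).
Qed.

(** Take [s'] between [delta * s] and [D]. A small ball meeting the points regular for [s'] has mass
    at most [(2 * r n) ^ s' <= c * r n ^ (delta * s)], hence at most the essential content of its
    shrunken ball, and belongs to the subfamily. The other balls avoid the regular set, whose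
    complement is given less than half of the mass guaranteed in [Omega]. *)
Lemma covering_subfamily s : asymptotically_covering mu (fun n => B n) setT ->
  0 < s -> s < D / delta ->
  asymptotically_covering mu (fun n => B n)
    (N_index mu (fun n => B n) (fun n => (ball_pow (x n) (r n) delta)°) s).
Proof.
move=> ac s0 sD; have mB n : borel (B n) by exact: borel_closed_ball.
have sD' : delta * s < D by rewrite mulrC -ltr_pdivlMr.
have ss : s <= delta * s by rewrite ler_peMl// ltW.
have [|c c0 cP] := content_ge s (ltW s0).
  by rewrite DE lte_fin (le_lt_trans ss).
pose s' := (delta * s + D) / 2.
have s'1 : delta * s < s' by rewrite ltr_pdivlMr// mulr_natr mulr2n ltrD2l.
have s'D : s' < D by rewrite ltr_pdivrMr// mulr_natr mulr2n ltrD2r.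
have s'0 : 0 <= s' by rewrite (le_trans _ (ltW s'1))// (le_trans _ ss)// ltW.
have [||t /andP[t0 t1] tP] := powR_small (s' - delta * s) (c / 2 `^ s').
- by rewrite subr_gt0.
- by rewrite divr_gt0// powR_gt0.
move: ac => /(asymptotically_coveringP _ _ _ mB)[C C0 ac].
apply/(asymptotically_coveringP _ _ _ mB).
exists (C / 2); first by rewrite divr_gt0.
move=> Omega g oO; have mO := borel_open _ oO.
have [PO|PO] := leP (P Omega) 0.
  exists [::]; split => //; rewrite seq_union_nil mass_set0.
  by rewrite pmulr_rle0// divr_gt0.
have tau0 : 0 < C * P Omega / 2 by rewrite !mulr_gt0.
have [|rr /andP[rr0 rr1] PG] := regular_points_mass mu s' _ s'0 _ tau0.
  by rewrite DE lte_fin.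
set G := regular_points mu s' rr in PG.
have mG : borel G by apply: borel_closed; exact: regular_points_closed.
have e0 : 0 < Num.min t (rr / 2) by rewrite lt_min t0 divr_gt0.
have [N NP] := eventually_lt _ _ r0 rlim e0.
have [J [uJ JP dJ CJ]] := ac Omega (maxn g N) oO.
pose Q n := `[< (B n `&` G) !=set0 >].
exists [seq n <- J | Q n]; split; first exact: filter_uniq.
- move=> n; rewrite mem_filter => /andP[/asboolP[y [By Gy]] /JP[_ + BO]].
  rewrite geq_max => /andP[gn /NP]; rewrite lt_min => /andP[rt rr2]; split => //.
  rewrite /N_index /=; apply: ereal_sup_ubound; exists s => //; split; first exact: ltW.
  rewrite ball_powE.
  have rho1 : 0 < rho n <= 1.
    rewrite rho0/= (le_trans (ge1r_powR _ delta1))// ?r0 (le_trans (ltW rt))//.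
  apply: le_trans (cP _ _ (xK n) rho1).
  rewrite massE// lee_fin (@le_trans _ _ ((2 * r n) `^ s'))//.
    rewrite (@le_trans _ _ (P (closed_ball y (2 * r n))))//.
      apply: le_mass => //; first exact: borel_closed_ball.
      apply: closed_ball_sub => //; first by rewrite mulr_gt0.
      move: By => /closed_ballP-/(_ (r0 n)) By.
      by rewrite mulr_natl mulr2n lerD2r.
    by apply: Gy; rewrite mulr_gt0//= mulrC -ltr_pdivlMr.
  rewrite powRM ?(ltW (r0 n))// -powRrM.
  have -> : r n `^ s' = r n `^ (delta * s) * r n `^ (s' - delta * s).
    by rewrite -powRD ?subrKC// (gt_eqF (r0 n)) implybT.
  rewrite mulrCA mulrC ler_wpM2r ?powR_ge0// mulrC -ler_pdivlMr ?powR_gt0//.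
  by apply: tP; rewrite r0 ltW.
- by move=> i j; rewrite !mem_filter => /andP[_ iJ] /andP[_ jJ]; exact: dJ.
have mU J' : borel (seq_union J' (fun n => B n)) by exact: borel_seq_union.
have : P (seq_union J (fun n => B n)) <= P (seq_union [seq n <- J | Q n] (fun n => B n)) + P (~` G).
  rewrite (le_trans _ (mass_subU _ _ _ _ _))//; last exact: borel_setC.
  apply: le_mass => //; first by apply: borel_setU => //; exact: borel_setC.
  move=> y [n /= nJ By]; have [Gy|nGy] := pselect (G y); last by right.
  left; exists n => //=; rewrite mem_filter nJ andbT.
  by apply/asboolP; exists y.
rewrite massC// => h1; lra.
Qed.

Lemma s_exponent_ge : asymptotically_covering mu (fun n => B n) setT ->
  ((D / delta)%:E <= s_exponent mu (fun n => B n)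
                      (fun n => (ball_pow (x n) (r n) delta)°))%E.
Proof.
move=> ac; have [Dp|Dn] := ltP 0 D; last first.
  have -> : D = 0 by apply/eqP; rewrite eq_le Dn D0.
  (* At exponent 0 every cover of a non-empty set costs at least 1, so every index qualifies. *)
  rewrite mul0r; apply: ereal_sup_ubound; exists 0 => //; split => //.
  rewrite [N_index _ _ _ _](_ : _ = setT)//.
  apply/seteqP; split => // n _; rewrite /N_index/=.
  apply: ereal_sup_ubound; exists 0 => //; split => //.
  rewrite ball_powE (@le_trans _ _ 1%E)//; first exact: probability_le1 (borel_closed_ball _ _).
  apply: le_ereal_inf_tmp => _ [E [mE EU EE] <-].
  apply: hausdorff_content0_ge1 => //; apply/set0P/negP => /eqP E0.
  have := P_ball_gt0 (x n) (rho n) (xK n) (rho0 n).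
  by rewrite /mass -EE E0 measure0 ltxx.
apply/lee_subgt0Pr => eps eps0; rewrite -EFinB.
pose s := Num.max (D / delta - eps) (D / delta / 2).
have Dd : 0 < D / delta by rewrite divr_gt0.
have s0 : 0 < s by rewrite lt_max [X in _ || X]divr_gt0// orbT.
have sD : s < D / delta.
  by rewrite gt_max gtrBl eps0/= ltr_pdivrMr// mulr_natr mulr2n ltrDl.
apply: (@le_trans _ _ s%:E); first by rewrite lee_fin le_max lexx.
apply: ereal_sup_ubound; exists s => //; split; first exact: ltW.
exact: covering_subfamily.
Qed.

Lemma gauge_lower_boundP : asymptotically_covering mu (fun n => B n) setT ->
  gauge_lower_bound mu delta x r.
Proof.
move=> ac; have dE : (dim_measure mu / delta%:E = (D / delta)%:E)%E.
  by rewrite /dim_measure DE inver gt_eqF// -EFinM.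
have [Dp|Dn] := ltP 0 D.
  have [zeta [gz lz Hz]] := dim_gauge K mu x r delta d0 r0 delta1 xK rlim frost ac D Dp DE.
  by exists zeta; split => //; exists (D / delta) => //; rewrite dE.
have D00 : D = 0 by apply/eqP; rewrite eq_le Dn D0.
exists point_gauge; split; first exact: gauge_point_gauge.
  by exists 0; [exact: point_gauge_cvg|rewrite dE D00 mul0r].
apply: point_gauge_measure => //; exact: limsup_nonempty.
Qed.

Lemma ubiquity : asymptotically_covering mu (fun n => B n) setT ->
  ubiquity_conclusions mu delta x r.
Proof.
move=> ac; have dE : (dim_measure mu / delta%:E = (D / delta)%:E)%E.
  by rewrite /dim_measure DE inver gt_eqF// -EFinM.
split.
- rewrite DE lte_fin => Dp; have tc := t_exponent_cvg Dp.
  split; first by apply/cvg_ex; exists D%:E.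
  by rewrite /t_exponent (cvg_lim _ tc)// /dim_measure DE.
- rewrite dE; exact: s_exponent_ge.
- exact: gauge_lower_boundP.
- have [zeta [[z0 _ _] [l zl Dl] Hz]] := gauge_lower_boundP ac.
  rewrite /dim_lower_bound (le_trans Dl)//.
  exact: hausdorff_dim_ge zl Hz.
Qed.

End ubiquity.

(** * Scales at which the measure is doubling *)

Section doubling_scale.
Context {R : realType} {d : nat}.
Local Notation V := 'rV[R]_d.
Variables (K : set V) (mu : probability (borel_rV R d) R) (c h : R).
Local Notation P := (mass mu).
Hypotheses (c0 : 0 < c) (h0 : 0 <= h).
Hypothesis P_ge : forall x r, K x -> 0 < r <= 1 -> c * r `^ h <= P (closed_ball x r).

(* Otherwise the mass would grow by the factor [3 `^ b] at each of the roughly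
   [eps * log_3 (1 / r)] triplings between the radii [r] and [r `^ (1 - eps)]. *)
Lemma doubling_scale (eps : R) : 0 < eps < 1 ->
  exists C t : R, 0 < t /\ forall x r, K x -> 0 < r < t -> exists rho,
    [/\ r <= rho, rho <= r `^ (1 - eps) &
        P (closed_ball x (3 * rho)) <= C * P (closed_ball x rho)].
Proof.
(* Chosen so that [eps * b = h + 1]: the growth would lift the mass from [c * r ^ h] to at least
   [c / r], which exceeds 1 for [r < c]. *)
move=> /andP[eps0 eps1]; pose b := (h + 1) / eps.
have b0 : 0 < b by rewrite divr_gt0// ltr_wpDl.
exists (3 `^ b), (Num.min c 1); split; first by rewrite lt_min c0 ltr01.
move=> x r Kx /andP[r0]; rewrite lt_min => /andP[rc r1].
have [N0 N0P] : exists N : nat, r `^ (- eps) < 3 ^+ N.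
  have [||N NP] := exists_expr_lt (3^-1 : R) (r `^ eps); rewrite ?powR_gt0//.
    by rewrite invr_ge0 ler0n/= invf_lt1// ltr1n.
  by exists N; rewrite powRN invf_plt ?posrE ?powR_gt0 ?exprn_gt0// -exprVn.
have exN : exists N : nat, r `^ (- eps) < 3 ^+ N by exists N0.
(* Minimality keeps the radii [3 ^ i * r] with [i < N] at most [r ^ (1 - eps)]. *)
pose N := ex_minn exN.
have [NP Nmin] : r `^ (- eps) < 3 ^+ N /\
    forall i, (i < N)%N -> (3 ^+ i : R) <= r `^ (- eps).
  rewrite /N; case: ex_minnP => n nP nm; split => // i ni.
  by rewrite leNgt; apply/negP => /nm; rewrite leqNgt ni.
apply: contrapT => none.
have grow i : (i <= N)%N ->
    (3 `^ b) ^+ i * P (closed_ball x r) <= P (closed_ball x (3 ^+ i * r)).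
  elim: i => [|i IH] iN; first by rewrite !expr0 !mul1r.
  rewrite exprS -mulrA exprS -mulrA.
  apply: (le_trans (ler_wpM2l (powR_ge0 _ _) (IH (ltnW iN)))).
  rewrite leNgt; apply/negP => /ltW h1; apply: none; exists (3 ^+ i * r); split => //.
    by rewrite ler_peMl ?(ltW r0)// exprn_ege1// ler1n.
  rewrite addrC powRD; last by rewrite (gt_eqF r0) implybT.
  by rewrite powRr1 ?(ltW r0)// ler_wpM2r ?(ltW r0)// Nmin.
have := grow N (leqnn N); apply/negP; rewrite -ltNge.
rewrite (le_lt_trans (mass_le1 _ _ (borel_closed_ball _ _)))//.
rewrite (@lt_le_trans _ _ ((3 `^ b) ^+ N * (c * r `^ h)))//; last first.
  by rewrite ler_wpM2l ?exprn_ge0 ?powR_ge0// P_ge// r0 ltW.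
rewrite -powR_mulrn ?powR_ge0// -powRrM mulrC [b * _]mulrC powRrM powR_mulrn//.
rewrite (@lt_le_trans _ _ (c * r `^ h * (r `^ (- eps)) `^ b))//; last first.
  rewrite ler_wpM2l ?mulr_ge0 ?powR_ge0 ?(ltW c0)//.
  by rewrite ge0_ler_powR ?nnegrE ?powR_ge0 ?(ltW b0) ?exprn_ge0// ltW.
rewrite -powRrM -mulrA -powRD; last by rewrite (gt_eqF r0) implybT.
rewrite (_ : h + - eps * b = - 1); last by rewrite /b; field; rewrite gt_eqF.
by rewrite powR_inv1 ?(ltW r0)// ltr_pdivlMr// mul1r.
Qed.

End doubling_scale.

Lemma attractor_sub_support {R : realType} {d : nat} (K : set 'rV[R]_d)
  (mu : probability (borel_rV R d) R) :
  (forall y e, K y -> 0 < e -> 0 < mass mu (ball y e)) -> K `<=` measure_support mu.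
Proof.
move=> Pb y Ky U oU Uy; rewrite (massE mu U); last exact: borel_open.
have : nbhs y U by apply: open_nbhs_nbhs; split.
rewrite -nbhs_ballE => -[e /= e0 eU]; rewrite lte_fin.
apply: lt_le_trans (Pb y e Ky e0) _; apply: le_mass => //; first exact: borel_ball.
exact: borel_open.
Qed.

(** The enlarged balls keep a limsup set of full mass, and the exponent [delta' = delta / (1 - eps)]
    compensates the enlargement: [rho ^ delta' <= r ^ delta] for large indices, so their limsup set
    at [delta'] is contained in the original one. The cost is a factor [1 - eps] in the
    dimension. *)
Lemma limsup_covering_dim {R : realType} {d : nat} (K : set 'rV[R]_d)
  (mu : probability (borel_rV R d) R) (D c h : R)
  (x : nat -> 'rV[R]_d) (r : nat -> R) (delta : R) :
  (0 < d)%N -> (forall n, 0 < r n) -> 1 <= delta -> (forall n, K (x n)) ->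
  r @ \oo --> 0 -> 0 <= D -> lower_hausdorff_dim mu = D%:E ->
  0 < c -> 0 <= h ->
  (forall x r, K x -> 0 < r <= 1 -> c * r `^ h <= mass mu (closed_ball x r)) ->
  (forall s, 0 <= s -> (s%:E < lower_hausdorff_dim mu)%E ->
    exists (A : R) (G : set 'rV[R]_d),
      [/\ 0 < A, borel G, 2^-1 <= mass mu G & frostman_sets mu K s A G]) ->
  mu (lim_sup_set (fun n => closed_ball (x n) (r n))) = 1%E ->
  dim_lower_bound mu delta x r.
Proof.
move=> d0 r0 delta1 xK rlim D0 DE c0 h0 Pge frost L1.
have delta0 : 0 < delta by rewrite (lt_le_trans ltr01).
rewrite /dim_lower_bound /dim_measure DE inver gt_eqF// -EFinM.
have [Dp|Dn] := ltP 0 D; last first.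
  have -> : D = 0 by apply/eqP; rewrite eq_le Dn D0.
  by rewrite mul0r; exact: hausdorff_dim_ge0.
set L := lim_sup_set _.
have Dd : 0 < D / delta by rewrite divr_gt0.
suff H eps : 0 < eps < 1 -> ((D / delta * (1 - eps))%:E <= hausdorff_dim L)%E.
  apply/lee_subgt0Pr => e e0.
  pose eps := Num.min 2^-1 (e / (D / delta)).
  apply: le_trans (H eps _); last first.
    by rewrite lt_min invr_gt0 ltr0n divr_gt0//= gt_min invf_lt1// ltr1n.
  rewrite -EFinB lee_fin mulrBr mulr1 lerD2l lerN2 mulrC -ler_pdivlMr//.
  by rewrite ge_min lexx orbT.
move=> /[dup] eps01 /andP[eps0 eps1].
have ne0 : 0 < 1 - eps by rewrite subr_gt0.
have [C [t [t0 tP]]] := doubling_scale K mu c h c0 h0 Pge eps eps01.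
have /choice[rho rhoP] n : exists rho, r n <= rho /\ (r n < t ->
    rho <= r n `^ (1 - eps) /\
    mass mu (closed_ball (x n) (3 * rho)) <= C * mass mu (closed_ball (x n) rho)).
  have [tr|rt] := leP t (r n); first by exists (r n); split.
  by have [|rho [h1 h2 h3]] := tP (x n) (r n) (xK n); rewrite ?r0//; exists rho.
have rho0 n : 0 < rho n by have [+ _] := rhoP n; exact: lt_le_trans.
have [N _ NP] : \forall n \near \oo, r n < t.
  by apply: (cvgr_lt 0 rlim); exact: t0.
have rholim : rho @ \oo --> 0.
  apply: (@squeeze_cvgr _ _ _ _ (fun=> 0) (fun n => r n `^ (1 - eps))).
  - exists N => // n /NP rt; have [_ /(_ rt)[h1 _]] := rhoP n.
    by rewrite h1 ltW.
  - exact: cvg_cst.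
  - exact: cvg_powR0.
pose delta' := delta / (1 - eps).
have delta'1 : 1 <= delta'.
  by rewrite ler_pdivlMr// mul1r (le_trans _ delta1)// gerBl ltW.
have L1' : mu (lim_sup_set (fun n => closed_ball (x n) (rho n))) = 1%E.
  apply/eqP; rewrite eq_le; apply/andP; split.
    apply: probability_le1; rewrite /lim_sup_set.
    apply: bigcap_measurable => [|n _]; first by exists 0%N.
    by apply: borel_bigcup => k _; exact: borel_closed_ball.
  rewrite -L1; apply: le_measure; rewrite ?inE.
  - apply: bigcap_measurable => [|n _]; first by exists 0%N.
    by apply: borel_bigcup => k _; exact: borel_closed_ball.
  - apply: bigcap_measurable => [|n _]; first by exists 0%N.
    by apply: borel_bigcup => k _; exact: borel_closed_ball.
  move=> y Ly n _; have [k nk yk] := Ly n I; exists k => //.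
  by apply: le_closed_ball yk; have [] := rhoP k.
have ac : asymptotically_covering mu (fun n => closed_ball (x n) (rho n)) setT.
  apply: (doubling_covering mu x rho C N rho0 rholim _ L1') => n /NP rt.
  by have [_ /(_ rt)[]] := rhoP n.
have [zeta [[z0 _ _] lz Hz]] := dim_gauge K mu x rho delta' d0 rho0 delta'1 xK rholim frost ac D Dp DE.
have -> : D / delta * (1 - eps) = D / delta'.
  by rewrite /delta'; field; rewrite !gt_eqF.
apply: (hausdorff_dim_ge _ _ _ d0 z0 lz).
apply: lt_le_trans Hz (hausdorff_measure_le _ _ _ _).
move=> y Ly n _; have [k /= nk yk] := Ly (maxn n N) I.
move: nk; rewrite geq_max => /andP[nk Nk]; exists k => //.
move: yk; apply: interiorS; rewrite /ball_pow; apply: le_closed_ball.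
have [_ /(_ (NP k Nk))[h1 _]] := rhoP k.
rewrite (@le_trans _ _ ((r k `^ (1 - eps)) `^ delta'))//.
  by rewrite ge0_ler_powR ?nnegrE ?powR_ge0 ?(ltW (rho0 k))// (le_trans _ delta'1).
by rewrite -powRrM /delta' mulrC divfK// gt_eqF.
Qed.

Theorem theorem2p11 (R : realType) (d m : nat) (hd : (0 < d)%N) (hm : (2 <= m)%N)
  (f : 'I_m -> 'rV[R]_d -> 'rV[R]_d)
  (hf : forall i, contracting_similarity (f i))
  (K : set 'rV[R]_d) (hK : is_attractor f K)
  (p : 'I_m -> R) (hp : probability_vector p)
  (mu : probability (borel_rV R d) R) (hmu : is_self_similar_measure f p mu)
  (x : nat -> 'rV[R]_d) (r : nat -> R)
  (hr : forall n, 0 < r n)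
  (hxK : forall n, K (x n))
  (hdiam : diam (closed_ball (x n) (r n)) @[n --> \oo] --> 0)
  (delta : R) (hdelta : 1 <= delta) :
  (asymptotically_covering mu (fun n => closed_ball (x n) (r n)) [set: nat] ->
     ubiquity_conclusions mu delta x r) /\
  (mu (lim_sup_set (fun n => closed_ball (x n) (r n))) = 1%E ->
     dim_lower_bound mu delta x r /\
     (doubling mu ->
        asymptotically_covering mu (fun n => closed_ball (x n) (r n)) [set: nat] /\
        ubiquity_conclusions mu delta x r)).
Proof.
have rlim : r @ \oo --> 0.
  rewrite -[X in _ --> X](mulr0 2^-1).
  rewrite (_ : r = fun n => 2^-1 * diam (closed_ball (x n) (r n))).
    by apply: cvgM; [exact: cvg_cst|exact: hdiam].
  by apply/funext => n; rewrite diam_closed_ball// mulKf.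
have D0 := lower_hausdorff_dim_ge0 mu.
have [D DE] : exists D : R, lower_hausdorff_dim mu = D%:E.
  exists (fine (lower_hausdorff_dim mu)); rewrite fineK// ge0_fin_numE//.
  exact: (lower_hausdorff_dim_lty f p K mu hm hf hK hp hmu).
rewrite DE lee_fin in D0.
have [c [h [c0 h0 Pge]]] := mass_closed_ball_ge f p K mu hm hf hK hp hmu.
have Pb y e : K y -> 0 < e -> 0 < mass mu (ball y e).
  move=> Ky e0; pose e' := Num.min 1 (e / 2).
  have e'0 : 0 < e' by rewrite lt_min ltr01 divr_gt0.
  apply: (@lt_le_trans _ _ (c * e' `^ h)); first by rewrite mulr_gt0// powR_gt0.
  rewrite (le_trans (Pge y e' Ky _))// ?e'0 ?ge_min ?lexx//.
  apply: le_mass; [exact: borel_closed_ball|exact: borel_ball|].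
  apply: closed_ball_sub_ball => //; rewrite subrr normr0 add0r gt_min.
  by rewrite [X in _ || X]ltr_pdivrMr// mulr_natr mulr2n ltrDl e0 orbT.
have frost s := frostman f p K mu hm hf hK hp hmu s.
have cont s := essential_content_ge f p K mu hm hf hK hp hmu s hd.
have ubi := ubiquity K mu D x r delta hd hr hdelta hxK rlim D0 DE Pb cont frost.
split=> // L1; split.
  exact: (limsup_covering_dim K mu D c h x r delta).
move=> [C C0 dbl].
suff ac : asymptotically_covering mu (fun n => closed_ball (x n) (r n)) setT.
  by split => //; exact: ubi.
(* Tripling is dominated by two doublings, whence [C * C]. *)
apply: (doubling_covering mu x r (C * C) 0 hr rlim _ L1) => n _.
have Sx : measure_support mu (x n) by exact: (attractor_sub_support K mu Pb).
have dblR e : 0 < e -> mass mu (closed_ball (x n) (2 * e)) <= C * mass mu (closed_ball (x n) e).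
  move=> e0; have := dbl (x n) e Sx e0.
  by rewrite !massE; try exact: borel_closed_ball; rewrite -EFinM lee_fin.
rewrite (@le_trans _ _ (mass mu (closed_ball (x n) (2 * (2 * r n)))))//.
  apply: le_mass; [exact: borel_closed_ball|exact: borel_closed_ball|].
  by apply: le_closed_ball; have := hr n; lra.
rewrite (le_trans (dblR _ _)) ?mulr_gt0// -mulrA ler_wpM2l ?(ltW C0)//.
exact: dblR.
Qed.
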